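(* Let $V \subseteq \mathbb{R}^N$ be a $(K,n)$ regular set with $[V]_N \leq t$. Then for any $\varepsilon \in (0, \operatorname{diam}(V)]$, $$\log \mathcal{N}(V,\varepsilon) \;\leq\; n \log\left(\frac{2\,t\,n\,N^{3/2}}{\varepsilon}\right) + \log(2K).$$ Moreover, for $N \geq 2$ the right-hand side equals $n\log(t/\varepsilon) + \mathcal{O}(n\log N + \log K)$ with an absolute implied constant.
   Context: Regular sets: for $0\le k\le N$ let $\overline{G}_N^k$ be the affine Grassmannian of $k$-dimensional affine subspaces (''planes'') of $\mathbb{R}^N$, equipped with the uniform measure $\mu=\mu_N^k$ invariant under rigid body transformations. A set $V\subseteq\mathbb{R}^N$ is a $(K,n)$ regular set in $\mathbb{R}^N$ if (1) for every $n'\le n$, for $\mu$-almost all planes $L$ of codimension $n'$ in $\mathbb{R}^N$, $V\cap L$ has at most $K$ path connected components; and (2) for every $n'\geq n+1$, for $\mu$-almost all planes $L$ of codimension $n'$ in $\mathbb{R}^N$, $V\cap L$ is empty. Size: $[V]_N$ denotes the smallest $r\ge 0$ such that $V$ is contained in a rigid body transformation of the cube $r\cdot[-1,1]^N$. Covering number: $\mathcal{N}(V,\varepsilon)$ is the minimal cardinality of a subset $S\subseteq V$ such that every $x\in V$ has some $y\in S$ with $\|x-y\|\le\varepsilon$ (Euclidean norm). $\log$ is the natural logarithm, and when $n=0$ the term $n\log(\cdot)$ is interpreted as $0$.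
   Formalization: The ''moreover'' estimate is stated for n ≤ N (n being a codimension in R^N); for n > N the definition still admits regular sets, e.g. a segment in R^2 with K = 1 and n large, and the O(n log N + log K) claim fails. The main bound is for all n. *)

(* Defs.v *)
From HB Require Import structures.
From mathcomp Require Import all_boot all_order all_algebra.
From mathcomp Require Import all_classical all_reals all_analysis.
Import Order.TTheory GRing.Theory Num.Theory.
Import numFieldNormedType.Exports.

Set Implicit Arguments.
Unset Strict Implicit.
Unset Printing Implicit Defensive.

Local Open Scope classical_set_scope.
Local Open Scope ring_scope.

Section Euclidean.
Context {R : realType} {N : nat}.
Implicit Types (V : set 'rV[R]_N) (eps : R).

(* The library norm on row vectors is the sup norm. *)
Definition enorm (x : 'rV[R]_N) : R := Num.sqrt (\sum_i x 0 i ^+ 2).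

(* +oo for unbounded V, and -oo rather than 0 for V empty. *)
Definition ediam V : \bar R :=
  ereal_sup [set (enorm (x - y))%:E | x in V & y in V].

(* Points are row vectors, so linear maps act on the right. *)
Definition rigid_transformation (g : 'rV[R]_N -> 'rV[R]_N) : Prop :=
  exists (Q : 'M[R]_N) (b : 'rV[R]_N),
    Q *m Q^T = 1%:M /\ forall x, g x = x *m Q + b.

Definition cube (r : R) : set 'rV[R]_N := [set x | forall i, `|x 0 i| <= r].

(* The infimum is +oo exactly when V is unbounded; otherwise it is attained,
   by compactness of the orthogonal group. *)
Definition set_size V : \bar R :=
  ereal_inf [set r%:E | r in [set r : R | 0 <= r /\
    exists2 g, rigid_transformation g & V `<=` g @` cube r]].

Definition eps_net V eps (S : set 'rV[R]_N) : Prop :=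
  S `<=` V /\ forall x, V x -> exists2 y, S y & enorm (x - y) <= eps.

(* Extended-real valued: +oo if V has no finite net. *)
Definition covering_number V eps : \bar R :=
  ereal_inf [set m%:R%:E | m in [set m : nat |
    exists2 S, eps_net V eps S & (S #= `I_m)%card]].

End Euclidean.

Section PathComponents.
Context {R : realType} {T : topologicalType}.

Definition path_joined (A : set T) (x y : T) : Prop :=
  exists f : R -> T,
    [/\ {within `[0, 1], continuous f}, f 0 = x, f 1 = y &
        f @` `[0, 1] `<=` A].

Definition path_components (A : set T) : set (set T) :=
  [set [set y | path_joined A x y] | x in A].

End PathComponents.

Section AffineGrassmannian.
Context {R : realType} {N : nat}.

Definition is_plane (k : nat) (L : set 'rV[R]_N) : Prop :=
  exists (p : 'rV[R]_N) (W : {vspace 'rV[R]_N}),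
    \dim W = k /\ L = [set p + w | w in [set` W]].

Record plane (k : 'I_N.+1) := Plane {
  plane_set :> set 'rV[R]_N;
  plane_setP : is_plane k plane_set }.

HB.instance Definition _ k := gen_eqMixin (plane k).
HB.instance Definition _ k := gen_choiceMixin (plane k).

Lemma coordinate_planeP (k : 'I_N.+1) :
  is_plane k [set 0 + w | w in [set` <<take k (vbasis {: 'rV[R]_N})>>%VS]].
Proof.
exists 0, <<take k (vbasis {: 'rV[R]_N})>>%VS; split=> //.
have := basis_free (vbasisP {: 'rV[R]_N}).
rewrite -[X in free X](cat_take_drop k) => /catl_free /eqP ->.
rewrite size_takel// size_tuple dimvf /dim /= mul1n.
by rewrite -ltnS ltn_ord.
Qed.

HB.instance Definition _ k :=
  isPointed.Build (plane k) (Plane (coordinate_planeP k)).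

(* Effros presentation of the Borel sigma-algebra of the space of k-planes:
   it is generated by the families of planes that meet a given open set. *)
Definition hitting_sets (k : 'I_N.+1) : set (set (plane k)) :=
  [set [set L : plane k | plane_set L `&` U !=set0] | U in open].

Definition affine_grassmannian (k : 'I_N.+1) :=
  g_sigma_algebraType (@hitting_sets k).

Definition plane_image (k : 'I_N.+1) (g : 'rV[R]_N -> 'rV[R]_N)
    (B : set (affine_grassmannian k)) : set (affine_grassmannian k) :=
  [set L | exists2 L0, B L0 & plane_set L = g @` plane_set L0].

(* These conditions characterize the uniform measure up to a positive scalar,
   so they determine which sets of planes are null: it is a nonzero Borel
   measure, locally finite (the planes meeting a ball have finite measure),
   and invariant under rigid transformations. *)
Definition uniform_measure (k : 'I_N.+1)
    (mu : {measure set (affine_grassmannian k) -> \bar R}) : Prop :=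
  [/\ (0 < mu setT)%E,
      forall r : R,
        (mu [set L | plane_set L `&` [set x | (enorm x < r)%R] !=set0]
          < +oo)%E &
      forall g B, rigid_transformation g -> measurable B ->
        mu (plane_image g B) = mu B].

(* A k-plane has codimension N - k, where k <= N since k : 'I_N.+1. *)
Definition regular_set
    (mu : forall k : 'I_N.+1, {measure set (affine_grassmannian k) -> \bar R})
    (K n : nat) (V : set 'rV[R]_N) : Prop :=
  (forall k : 'I_N.+1, (N - k <= n)%N ->
    {ae mu k, forall L : affine_grassmannian k,
      (path_components (R := R) (V `&` plane_set L) #<= `I_K)%card}) /\
  (forall k : 'I_N.+1, (n + 1 <= N - k)%N ->
    {ae mu k, forall L : affine_grassmannian k,
      V `&` plane_set L = set0}).

End AffineGrassmannian.

Arguments plane R {N} k.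
Arguments affine_grassmannian R {N} k.

(* n * ln 0 = 0 for n = 0, as ln 0 = 0 in the library. *)
Definition covering_bound {R : realType} (N K n : nat) (t eps : R) : R :=
  n%:R * ln (2 * t * n%:R * N%:R `^ (3 / 2) / eps) + ln (2 * K%:R).

(* Main.v *)
Require Import Defs.
From HB Require Import structures.
From mathcomp Require Import all_boot all_order all_algebra.
From mathcomp Require Import all_classical all_reals all_analysis.
From mathcomp Require Import measurable_realfun ring lra zify.
Import Order.TTheory GRing.Theory Num.Theory.
Import numFieldNormedType.Exports.
Local Open Scope classical_set_scope.
Local Open Scope ring_scope.

Set Implicit Arguments.
Unset Strict Implicit.
Unset Printing Implicit Defensive.

(** Hyperplanes parallel to the faces of a cube around V, m of them in each
    direction, cut the cube into cells of side eps / sqrt N, hence of diameter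
    eps. Intersections of these hyperplanes are the flats of the grid. Given x
    in V, choose, among the flats that meet V inside the closed cell of x, one
    of largest codimension, and a point y where it does. The path component of
    y in the slice of V by this flat stays in the cell of x: a path that leaves
    the cell crosses one of its walls, and the crossing point lies on a flat of
    larger codimension ([component_in_cell]). So every point of that component
    is within eps of x, and one point in each component of each slice makes a
    net. Slices of codimension above n are empty, the others have at most K
    components, and there are at most (1 + N m) ^ n of them ([grid_net]). With
    m = floor (2 t sqrt N / eps) this count is at most twice
    (2 t n N ^ (3/2) / eps) ^ n ([card_slices_le]).

    Regularity concerns almost all planes only, so the grid has to be put in
    general position by a rigid motion close to the identity
    ([generic_rigid]); as (m + 1) eps > 2 t sqrt N strictly, the grid still
    covers V. Such a motion comes from N + 1 points of space drawn
    successively for the measure on 0-planes: one point is the origin and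
    Gram-Schmidt turns the N edges out of it into an orthonormal frame. Let B
    be a null set of k-planes. For a fixed frame g the set g(B) is null by
    invariance, so by Fubini some k-plane L avoids g(B) for almost all frames
    g ([exists_not_bad]). Gram-Schmidt commutes with rigid motions and the
    measure on points is invariant, so the property passes from L to its
    images, which are all the k-planes ([exceptional_not_bad]). Finally,
    the tuples of points close to the origin and the ends of the unit vectors
    are not negligible, so that one of them serves for all the flats of the grid.

    The bound exceeds n ln (t / eps) by n ln (2 n N ^ (3/2)) + ln (2 K). For
    n <= N this is O(n ln N + ln K), except that for n = 0 and K = 1 the
    latter vanishes; but then one ball of radius eps / 3 would contain V,
    whose diameter is at least eps ([regular_K_gt1]). *)

(** * Euclidean geometry of row vectors *)

Section Dot.
Context {R : realType} {N : nat}.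
Implicit Types (x y z : 'rV[R]_N) (Q : 'M[R]_N).

Definition dot x y : R := (x *m y^T) 0 0.

Lemma dotE x y : dot x y = \sum_i x 0 i * y 0 i.
Proof. by rewrite /dot mxE; apply: eq_bigr => i _; rewrite mxE. Qed.

Lemma dotC x y : dot x y = dot y x.
Proof. by rewrite !dotE; apply: eq_bigr => i _; rewrite mulrC. Qed.

Lemma dotDl x y z : dot (x + y) z = dot x z + dot y z.
Proof. by rewrite /dot mulmxDl mxE. Qed.

Lemma dotZl a x z : dot (a *: x) z = a * dot x z.
Proof. by rewrite /dot -scalemxAl mxE. Qed.

Lemma dotBl x y z : dot (x - y) z = dot x z - dot y z.
Proof. by rewrite -scaleN1r dotDl dotZl mulN1r. Qed.

Lemma dotDr x y z : dot x (y + z) = dot x y + dot x z.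
Proof. by rewrite !(dotC x) dotDl. Qed.

Lemma dotZr a x y : dot x (a *: y) = a * dot x y.
Proof. by rewrite !(dotC x) dotZl. Qed.

Lemma dotBr x y z : dot x (y - z) = dot x y - dot x z.
Proof. by rewrite !(dotC x) dotBl. Qed.

Lemma dot_ge0 x : 0 <= dot x x.
Proof. by rewrite dotE sumr_ge0// => i _; rewrite -expr2 sqr_ge0. Qed.

Lemma dot_eq0 x : (dot x x == 0) = (x == 0).
Proof.
apply/eqP/eqP => [|->]; last by rewrite /dot mul0mx mxE.
rewrite dotE => /eqP; rewrite psumr_eq0; last first.
  by move=> i _; rewrite -expr2 sqr_ge0.
move=> /allP h; apply/rowP => i; rewrite mxE.
by have := h i (mem_index_enum _); rewrite mulf_eq0 orbb => /eqP.
Qed.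

Lemma enormE x : enorm x = Num.sqrt (dot x x).
Proof. by rewrite /enorm dotE; under eq_bigr do rewrite expr2. Qed.

Lemma enorm_ge0 x : 0 <= enorm x.
Proof. exact: sqrtr_ge0. Qed.

Lemma enormN x : enorm (- x) = enorm x.
Proof. by rewrite !enormE -scaleN1r dotZl dotZr; congr Num.sqrt; ring. Qed.

Lemma enorm0 : enorm (0 : 'rV[R]_N) = 0.
Proof. by rewrite enormE /dot mul0mx mxE sqrtr0. Qed.

Lemma enorm_sqr x : enorm x ^+ 2 = dot x x.
Proof. by rewrite enormE sqr_sqrtr// dot_ge0. Qed.

Lemma dot_CauchySchwarz x y : dot x y <= enorm x * enorm y.
Proof.
have [->|y0] := eqVneq y 0.
  by rewrite dotC -(scale0r 0) dotZl mul0r scale0r enorm0 mulr0.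
have yy : 0 < dot y y by rewrite lt_def dot_ge0 dot_eq0 y0.
have [xy0|xy0] := leP (dot x y) 0.
  by rewrite (le_trans xy0)// mulr_ge0// enorm_ge0.
rewrite -(@ler_pXn2r _ 2)// ?nnegrE ?mulr_ge0 ?enorm_ge0//; last exact: ltW.
rewrite exprMn !enorm_sqr.
have := dot_ge0 (dot y y *: x - dot x y *: y).
rewrite dotBl !dotBr !dotZl !dotZr (dotC y x).
set a := dot x y; set b := dot y y; set c := dot x x => h.
have : 0 <= b * (c * b - a ^+ 2).
  by apply: le_trans h _; rewrite le_eqVlt; apply/orP; left; apply/eqP; ring.
by rewrite pmulr_rge0// subr_ge0.
Qed.

Lemma enormD x y : enorm (x + y) <= enorm x + enorm y.
Proof.
rewrite -(@ler_pXn2r _ 2)// ?nnegrE ?addr_ge0 ?enorm_ge0//.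
rewrite sqrrD !enorm_sqr dotDl !dotDr (dotC y x).
have := dot_CauchySchwarz x y; lra.
Qed.

Lemma enorm_distC x y : enorm (x - y) = enorm (y - x).
Proof. by rewrite -enormN opprB. Qed.

Lemma enormB x y z : enorm (x - z) <= enorm (x - y) + enorm (y - z).
Proof. by apply: le_trans (enormD _ _); rewrite addrA subrK. Qed.

Lemma coord_le_enorm x i : `|x 0 i| <= enorm x.
Proof.
rewrite /enorm -sqrtr_sqr ler_wsqrtr// (bigD1 i)//= lerDl.
by rewrite sumr_ge0// => j _; rewrite sqr_ge0.
Qed.

Lemma enorm_le_coord x (w : R) : 0 <= w -> (forall i, `|x 0 i| <= w) ->
  enorm x <= Num.sqrt N%:R * w.
Proof.
move=> w0 h; rewrite -[X in _ * X](ger0_norm w0) -sqrtr_sqr -sqrtrM//.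
rewrite /enorm ler_wsqrtr// mulr_natl -[N in _ *+ N]card_ord -sumr_const.
by apply: ler_sum => i _; rewrite -[leLHS]real_normK ?num_real// lerXn2r// nnegrE.
Qed.

Lemma enorm_eq0 x : enorm x = 0 -> x = 0.
Proof. by move=> h; apply/eqP; rewrite -dot_eq0 -enorm_sqr h expr0n. Qed.

Lemma dot_orthogonal Q x y : Q *m Q^T = 1%:M -> dot (x *m Q) (y *m Q) = dot x y.
Proof. by move=> h; rewrite /dot trmx_mul mulmxA -(mulmxA x) h mulmx1. Qed.

Lemma enorm_orthogonal Q x : Q *m Q^T = 1%:M -> enorm (x *m Q) = enorm x.
Proof. by move=> h; rewrite !enormE dot_orthogonal. Qed.

End Dot.

Section Rigid.
Context {R : realType} {N : nat}.
Implicit Types (x y z b c : 'rV[R]_N) (Q U : 'M[R]_N).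

Definition rigid Q b x := x *m Q + b.

Lemma rigidP Q b : Q *m Q^T = 1%:M -> rigid_transformation (rigid Q b).
Proof. by move=> h; exists Q, b. Qed.

Lemma rigidE g : rigid_transformation g ->
  exists Q b, Q *m Q^T = 1%:M /\ g = rigid Q b.
Proof. by move=> [Q [b [h1 h2]]]; exists Q, b; split=> //; apply/funext. Qed.

Lemma rigidB Q b x y : rigid Q b x - rigid Q b y = (x - y) *m Q.
Proof. by rewrite /rigid opprD addrACA subrr addr0 mulmxBl. Qed.

Lemma rigid_comp Q b U c x : rigid U c (rigid Q b x) = rigid (Q *m U) (b *m U + c) x.
Proof. by rewrite /rigid mulmxDl mulmxA addrA. Qed.

Definition rigid_inv Q b x := (x - b) *m Q^T.

Lemma rigid_invE Q b : rigid_inv Q b = rigid Q^T (- b *m Q^T).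
Proof. by apply/funext => x; rewrite /rigid_inv /rigid mulmxBl mulNmx. Qed.

Lemma rigidK Q b : Q *m Q^T = 1%:M -> cancel (rigid Q b) (rigid_inv Q b).
Proof. by move=> h x; rewrite /rigid_inv /rigid addrK -mulmxA h mulmx1. Qed.

Lemma rigid_invK Q b : Q *m Q^T = 1%:M -> cancel (rigid_inv Q b) (rigid Q b).
Proof.
by move=> /mulmx1C h x; rewrite /rigid_inv /rigid -mulmxA h mulmx1 subrK.
Qed.

Lemma orthogonal_trmx Q : Q *m Q^T = 1%:M -> Q^T *m (Q^T)^T = 1%:M.
Proof. by rewrite trmxK; exact: mulmx1C. Qed.

Lemma rigid_inv_rigid Q b : Q *m Q^T = 1%:M ->
  rigid_transformation (rigid_inv Q b).
Proof. by move=> h; rewrite rigid_invE; exact/rigidP/orthogonal_trmx. Qed.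

Lemma enorm_rigid Q b x y : Q *m Q^T = 1%:M ->
  enorm (rigid Q b x - rigid Q b y) = enorm (x - y).
Proof. by move=> h; rewrite rigidB enorm_orthogonal. Qed.

Lemma enorm_rigid_inv Q b x y : Q *m Q^T = 1%:M ->
  enorm (rigid_inv Q b x - rigid_inv Q b y) = enorm (x - y).
Proof. by move=> h; rewrite rigid_invE enorm_rigid//; exact: orthogonal_trmx. Qed.

End Rigid.

Section Planes.
Context {R : realType} {N : nat}.
Implicit Types (p : 'rV[R]_N).

(** Matrices with independent rows are easier to move than subspaces: a linear
    map acts on them by right multiplication. *)
Lemma is_planeP k (L : set 'rV[R]_N) : is_plane k L <->
  exists p (M : 'M[R]_(k, N)), row_free M /\ L = [set p + u *m M | u in setT].
Proof.
split.
  move=> [p [W [<- ->]]]; exists p, (\matrix_(i < \dim W) (vbasis W)`_i).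
  have mulE (u : 'rV_(\dim W)) : u *m \matrix_(i < \dim W) (vbasis W)`_i =
      \sum_i u 0 i *: (vbasis W)`_i.
    by rewrite mulmx_sum_row; apply: eq_bigr => i _; rewrite rowK.
  split.
    apply/row_freeP.
    have /freeP fr : free (vbasis W) by exact: basis_free (vbasisP W).
    apply/row_freeP; rewrite -kermx_eq0; apply/eqP/row_matrixP => i.
    rewrite row0; set v := row i _; apply/rowP => j; rewrite [RHS]mxE.
    apply: (fr (fun j => v 0 j)); rewrite -mulE; apply/sub_kermxP.
    exact: row_sub.
  apply/seteqP; split=> [_ [w Ww <-]|_ [u _ <-]].
    exists (\row_i coord (vbasis W) i w) => //; rewrite mulE.
    congr (_ + _); rewrite [RHS](coord_vbasis Ww).
    by apply: eq_bigr => i _; rewrite mxE.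
  exists (u *m \matrix_(i < \dim W) (vbasis W)`_i) => //=.
  rewrite mulE; apply: memv_suml => i _; apply: memvZ.
  by apply: vbasis_mem; rewrite mem_nth// size_tuple.
move=> [p [M [fM ->]]].
have [X mulE] : exists X : k.-tuple 'rV[R]_N,
    forall u : 'rV_k, u *m M = \sum_(i < k) u 0 i *: X`_i.
  exists [tuple row i M | i < k] => u.
  rewrite mulmx_sum_row; apply: eq_bigr => i _.
  by rewrite -tnth_nth tnth_mktuple.
exists p, <<X>>%VS; split.
  suff /eqP -> : free X by rewrite size_tuple.
  apply/freeP => c c0.
  have : (\row_i c i) *m M = 0 *m M.
    by rewrite mul0mx -[RHS]c0 mulE; apply: eq_bigr => i _; rewrite mxE.
  by move=> /(row_free_inj fM) /rowP h i; have := h i; rewrite !mxE.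
apply/seteqP; split=> [_ [u _ <-]|_ [w /= wM <-]].
  exists (u *m M) => //=; rewrite mulE; apply: memv_suml => i _; apply: memvZ.
  by apply: memv_span; rewrite mem_nth// size_tuple.
exists (\row_i coord X i w) => //.
rewrite mulE [in RHS](coord_span wM); congr (_ + _).
by apply: eq_bigr => i _; rewrite mxE.
Qed.

(** Dimension count: inside W the vectors orthogonal to j given ones form a space
    of rank at least rank W - j, so one more unit vector can be added. *)
Lemma orthonormal_extension d (W : 'M[R]_(d, N)) j k (A : 'M[R]_(j, N)) :
  A *m A^T = 1%:M -> (A <= W)%MS -> (j + k <= \rank W)%N ->
  exists B : 'M[R]_(k, N),
    [/\ B *m B^T = 1%:M, A *m B^T = 0 & (B <= W)%MS].
Proof.
elim: k j A => [|k IH] j A AA AW jk.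
  exists 0; split; [by apply/matrixP => -[]|exact: thinmx0|exact: sub0mx].
have : (0 < \rank (W :&: kermx A^T))%N.
  have := mxrank_sum_cap W (kermx A^T); rewrite mxrank_ker mxrank_tr.
  have : (\rank A <= j)%N by exact: rank_leq_row.
  have : (\rank (W + kermx A^T) <= N)%N by exact: rank_leq_col.
  have : (\rank A <= N)%N by exact: rank_leq_col.
  lia.
rewrite lt0n mxrank_eq0 => /rowV0Pn [v].
rewrite sub_capmx => /andP [vW /sub_kermxP vA] v0.
have vv : 0 < dot v v by rewrite lt_def dot_ge0 dot_eq0 v0.
have ev : 0 < enorm v by rewrite enormE sqrtr_gt0.
pose w := (enorm v)^-1 *: v.
have wW : (w <= W)%MS by rewrite scalemx_sub.
have wA : w *m A^T = 0 by rewrite -scalemxAl vA scaler0.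
have ww : w *m w^T = 1%:M.
  apply/matrixP => a b; rewrite !ord1 [LHS](_ : _ = dot w w)// dotZl dotZr.
  rewrite -enorm_sqr [RHS]mxE eqxx; set e := enorm v.
  by rewrite /=; field; rewrite gt_eqF.
have Aw : A *m w^T = 0 by rewrite -[LHS]trmxK trmx_mul trmxK wA trmx0.
have [|||B [BB AB BW]] := IH (j + 1)%N (col_mx A w).
- by rewrite tr_col_mx mul_col_row AA wA Aw ww -scalar_mx_block.
- by rewrite col_mx_sub AW wW.
- by rewrite -addnA add1n.
move: AB; rewrite mul_col_mx -[RHS]col_mx0 => /eq_col_mx [AB wB].
have Bw : B *m w^T = 0 by rewrite -[LHS]trmxK trmx_mul trmxK wB trmx0.
suff : exists B0 : 'M[R]_(1 + k, N),
    [/\ B0 *m B0^T = 1%:M, A *m B0^T = 0 & (B0 <= W)%MS] by [].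
exists (col_mx w B); split.
- by rewrite tr_col_mx mul_col_row ww wB Bw BB -scalar_mx_block.
- by rewrite tr_col_mx mul_mx_row Aw AB row_mx0.
- by rewrite col_mx_sub wW BW.
Qed.

Lemma is_plane_orthonormal k (L : set 'rV[R]_N) : is_plane k L ->
  exists p (A : 'M[R]_(k, N)),
    A *m A^T = 1%:M /\ L = [set p + u *m A | u in setT].
Proof.
move=> /is_planeP [p [M [fM ->]]].
have [|||A [AA _ AM]] := @orthonormal_extension _ M 0 k (0 : 'M[R]_(0, N)).
- by apply/matrixP => -[].
- exact: sub0mx.
- by move: fM; rewrite /row_free add0n => /eqP ->.
exists p, A; split=> //.
have fA : row_free A by apply/row_freeP; exists A^T.
have MA : (M <= A)%MS.
  have := mxrank_leqif_sup AM; move: fA fM; rewrite /row_free => /eqP -> /eqP ->.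
  by case=> _ <-.
apply/seteqP; split=> [_ [u _ <-]|_ [u _ <-]].
  by exists (u *m (M *m pinvmx A)) => //; rewrite -mulmxA mulmxKpV.
by exists (u *m (A *m pinvmx M)) => //; rewrite -mulmxA mulmxKpV.
Qed.

(** Complete both families to orthonormal bases; Q sends the first completed
    basis to the second. *)
Lemma orthonormal_transitive k (A1 A2 : 'M[R]_(k, N)) :
  A1 *m A1^T = 1%:M -> A2 *m A2^T = 1%:M ->
  exists Q : 'M[R]_N, Q *m Q^T = 1%:M /\ A1 *m Q = A2.
Proof.
move=> h1 h2.
have kN : (k <= N)%N.
  have /eqP <- : row_free A1 by apply/row_freeP; exists A1^T.
  exact: rank_leq_col.
have compl (A : 'M[R]_(k, N)) : A *m A^T = 1%:M ->
    exists B : 'M[R]_(N - k, N), [/\ B *m B^T = 1%:M, A *m B^T = 0 & A^T *m A + B^T *m B = 1%:M].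
  move=> h; have [||B [BB AB _]] := @orthonormal_extension _ 1%:M k (N - k) _ h.
  - exact: submx1.
  - by rewrite mxrank1 subnKC.
  exists B; split=> //.
  have BA : B *m A^T = 0 by rewrite -[LHS]trmxK trmx_mul trmxK AB trmx0.
  move: B BB AB BA; move: (N - k)%N (subnKC kN) => l e; case: N / e A h => A h B BB AB BA.
  have : col_mx A B *m (col_mx A B)^T = 1%:M.
    by rewrite tr_col_mx mul_col_row h AB BA BB -scalar_mx_block.
  by move=> /mulmx1C; rewrite tr_col_mx mul_row_col.
have [B1 [BB1 AB1 C1]] := compl _ h1.
have [B2 [BB2 AB2 C2]] := compl _ h2.
have BA2 : B2 *m A2^T = 0 by rewrite -[LHS]trmxK trmx_mul trmxK AB2 trmx0.
exists (A1^T *m A2 + B1^T *m B2); split.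
  rewrite linearD /= !trmx_mul !trmxK mulmxDl !mulmxDr.
  rewrite !mulmxA -!(mulmxA _ A2) -!(mulmxA _ B2) h2 AB2 BA2 BB2.
  by rewrite !mulmx0 !mul0mx addr0 add0r !mulmx1.
by rewrite mulmxDr !mulmxA h1 AB1 mul0mx addr0 mul1mx.
Qed.

Lemma plane_transitive k (L1 L2 : set 'rV[R]_N) : is_plane k L1 -> is_plane k L2 ->
  exists Q b, Q *m Q^T = 1%:M /\ L2 = rigid Q b @` L1.
Proof.
move=> /is_plane_orthonormal [p1 [A1 [h1 ->]]].
move=> /is_plane_orthonormal [p2 [A2 [h2 ->]]].
have [Q [QQ AQ]] := orthonormal_transitive h1 h2.
exists Q, (p2 - p1 *m Q); split=> //.
have e u : rigid Q (p2 - p1 *m Q) (p1 + u *m A1) = p2 + u *m A2.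
  by rewrite /rigid mulmxDl -mulmxA AQ addrC addrA subrK.
apply/seteqP; split=> [_ [u _ <-]|_ [_ [u _ <-] <-]]; last by exists u.
by exists (p1 + u *m A1) => //; exists u.
Qed.

Lemma is_plane_rigid k (L : set 'rV[R]_N) g : rigid_transformation g ->
  is_plane k L -> is_plane k (g @` L).
Proof.
move=> /rigidE [Q [b [QQ ->]]] /is_planeP [p [M [fM ->]]].
apply/is_planeP; exists (rigid Q b p), (M *m Q); split.
  apply/row_freeP; move/row_freeP: fM => [B MB]; exists (Q^T *m B).
  by rewrite mulmxA -(mulmxA M) QQ mulmx1.
have e u : rigid Q b (p + u *m M) = rigid Q b p + u *m (M *m Q).
  by rewrite /rigid mulmxDl -mulmxA addrAC.
apply/seteqP; split=> [_ [_ [u _ <-] <-]|_ [u _ <-]]; first by exists u.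
by exists (p + u *m M) => //; exists u.
Qed.

End Planes.

(** * Gram-Schmidt orthonormalization *)

Section GramSchmidt.
Context {R : realType} {N : nat}.
Implicit Types (x u : 'rV[R]_N) (v : nat -> 'rV[R]_N) (Q : 'M[R]_N).

Definition normalize x := (enorm x)^-1 *: x.

(** Instead of subtracting the projections on all previous vectors, each step
    projects the whole remaining family along its normalized head. Statements
    about all families then follow by plain induction on j. *)
Fixpoint gs v j : 'rV[R]_N :=
  let u := normalize (v 0) in
  if j is j'.+1 then gs (fun i => v i.+1 - dot (v i.+1) u *: u) j' else u.

Lemma gs_mul v Q j : Q *m Q^T = 1%:M ->
  gs (fun i => v i *m Q) j = gs v j *m Q.
Proof.
move=> QQ; have nQ x : normalize (x *m Q) = normalize x *m Q.
  by rewrite /normalize enorm_orthogonal// scalemxAl.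
elim: j v => [|j IH] v /=; first exact: nQ.
rewrite -IH; congr gs; apply/funext => i.
by rewrite nQ dot_orthogonal// mulmxBl scalemxAl.
Qed.

Lemma dot_normalize x : x != 0 -> dot (normalize x) (normalize x) = 1.
Proof.
move=> x0; rewrite dotZl dotZr -enorm_sqr; field.
by apply: contra_neq x0; exact: enorm_eq0.
Qed.

(** Gram-Schmidt only forms linear combinations of the given vectors. *)
Lemma gs_orthogonal_to v u : (forall i, dot (v i) u = 0) ->
  forall j, dot (gs v j) u = 0.
Proof.
move=> vu j; elim: j v vu => [|j IH] v vu /=; first by rewrite dotZl vu mulr0.
by apply: IH => i; rewrite dotBl !dotZl !vu !mulr0 subr0.
Qed.

(** The vectors are orthogonal even for a dependent family, because normalizing
    0 gives 0. *)
Lemma gs_orthogonal v i j : (i < j)%N -> dot (gs v j) (gs v i) = 0.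
Proof.
elim: i j v => [|i IH] [//|j] v; last exact: IH.
move=> _ /=; apply: gs_orthogonal_to => k.
rewrite dotBl dotZl; have [v0|v0] := eqVneq (v 0) 0.
  by rewrite v0 /normalize scaler0 !(dotC _ 0) -(scale0r 0) !dotZl !mul0r subrr.
by rewrite dot_normalize// mulr1 subrr.
Qed.

Lemma gs_unit v j : gs v j != 0 -> dot (gs v j) (gs v j) = 1.
Proof.
elim: j v => [|j IH] v /= h; last exact: IH.
by apply: dot_normalize; apply: contra_neq h => ->; rewrite /normalize scaler0.
Qed.

Lemma coordBZ x u a c : (x - a *: u) 0 c = x 0 c - a * u 0 c.
Proof. by rewrite !mxE. Qed.

Section Measurability.
Context d (T : measurableType d).

Lemma measurable_dot (x y : T -> 'rV[R]_N) :
  (forall c, measurable_fun setT (fun t => x t 0 c)) ->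
  (forall c, measurable_fun setT (fun t => y t 0 c)) ->
  measurable_fun setT (fun t => dot (x t) (y t)).
Proof.
move=> mx my; under eq_fun do rewrite dotE.
by apply: measurable_sum => c; exact: measurable_funM.
Qed.

Lemma measurable_enorm (x : T -> 'rV[R]_N) :
  (forall c, measurable_fun setT (fun t => x t 0 c)) ->
  measurable_fun setT (fun t => enorm (x t)).
Proof.
move=> mx; under eq_fun do rewrite enormE.
have msqrt : measurable_fun setT (@Num.sqrt R).
  by apply: continuous_measurable_fun; exact: sqrt_continuous.
by apply: (measurableT_comp msqrt); exact: measurable_dot.
Qed.

Lemma measurable_normalize (x : T -> 'rV[R]_N) :
  (forall c, measurable_fun setT (fun t => x t 0 c)) ->
  forall c, measurable_fun setT (fun t => normalize (x t) 0 c).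
Proof.
move=> mx c; under eq_fun do rewrite mxE -powR_inv1 ?enorm_ge0//.
apply: measurable_funM => //.
by apply: (measurableT_comp (measurable_powR (-1))); exact: measurable_enorm.
Qed.

Lemma measurable_gs (v : T -> nat -> 'rV[R]_N) :
  (forall i c, measurable_fun setT (fun t => v t i 0 c)) ->
  forall j c, measurable_fun setT (fun t => gs (v t) j 0 c).
Proof.
move=> mv j; elim: j v mv => [|j IH] v mv c /=; first exact: measurable_normalize.
apply: (IH (fun t i => _ : 'rV[R]_N)) => i {}c.
under eq_fun do rewrite coordBZ.
apply: measurable_funB => //; apply: measurable_funM; last exact: measurable_normalize.
by apply: measurable_dot => // {}c; exact: measurable_normalize.
Qed.

End Measurability.

Section Continuity.
Context (T : Type) (F : set_system T) {FF : ProperFilter F}.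

Lemma cvg_dot (x y : T -> 'rV[R]_N) (a b : 'rV[R]_N) :
  (forall c, x t 0 c @[t --> F] --> a 0 c) ->
  (forall c, y t 0 c @[t --> F] --> b 0 c) ->
  dot (x t) (y t) @[t --> F] --> dot a b.
Proof.
move=> xa yb; rewrite dotE; under eq_fun do rewrite dotE.
apply: cvg_big => [|c _]; first exact: add_continuous.
exact: cvgM.
Qed.

Lemma cvg_normalize (x : T -> 'rV[R]_N) (a : 'rV[R]_N) : dot a a = 1 ->
  (forall c, x t 0 c @[t --> F] --> a 0 c) ->
  forall c, normalize (x t) 0 c @[t --> F] --> a 0 c.
Proof.
move=> aa xa c; under eq_fun do rewrite mxE.
have n1 : enorm (x t) @[t --> F] --> (1 : R).
  have -> : 1 = Num.sqrt (dot a a) by rewrite aa sqrtr1.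
  under eq_fun do rewrite enormE.
  by apply: continuous_cvg; [exact: sqrt_continuous|exact: cvg_dot].
have := cvgM (cvgV (oner_neq0 R) n1) (xa c); rewrite invr1 mul1r; exact.
Qed.

(** At an orthonormal limit no inverse norm blows up, so that the recursion is
    continuous step by step, and every projection tends to 0. *)
Lemma cvg_gs (v : T -> nat -> 'rV[R]_N) (l : nat -> 'rV[R]_N) j :
  (forall i c, v t i 0 c @[t --> F] --> l i 0 c) ->
  (forall i, (i <= j)%N -> dot (l i) (l i) = 1) ->
  (forall i i', i != i' -> dot (l i) (l i') = 0) ->
  forall c, gs (v t) j 0 c @[t --> F] --> l j 0 c.
Proof.
elim: j v l => [|j IH] v l vl l1 l0 c /=.
  by apply: cvg_normalize => //; exact: l1.
apply: (IH (fun t i => _ : 'rV[R]_N) (fun i => l i.+1)); first last.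
- by move=> i i' ii'; exact: l0.
- by move=> i ij; exact: l1.
move=> i {}c.
have nl := cvg_normalize (l1 0%N (leq0n _)) (vl 0%N).
have nd := cvg_dot (vl i.+1) nl.
have := cvgB (vl i.+1 c) (cvgM nd (nl c)); rewrite l0// mul0r subr0.
by move=> h; under eq_fun do rewrite coordBZ; exact: h.
Qed.

End Continuity.

End GramSchmidt.

(** * Orthonormal frames from points *)

Section Frame.
Context {R : realType} {N : nat}.
Implicit Types (P : 'I_N.+1 -> 'rV[R]_N) (Q : 'M[R]_N) (x b : 'rV[R]_N).

(** [inord] maps indices beyond N to 0, so the vectors beyond the N-th vanish. *)
Definition edges P (i : nat) : 'rV[R]_N := P (inord i.+1) - P ord0.

Lemma edgesE P i c : edges P i 0 c = P (inord i.+1) 0 c - P ord0 0 c.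
Proof. by rewrite !mxE. Qed.

Definition frame P : 'M[R]_N := \matrix_(i < N) gs (edges P) i.

Definition frame_map P : 'rV[R]_N -> 'rV[R]_N := rigid (frame P) (P ord0).

Definition nondegenerate P := frame P *m (frame P)^T = 1%:M.

(** The differences of points ignore the translation, and the rotation commutes
    with Gram-Schmidt. This equivariance makes random frames sample rigid motions
    without preference. *)
Lemma frame_rigid P Q b : Q *m Q^T = 1%:M ->
  frame (fun i => rigid Q b (P i)) = frame P *m Q.
Proof.
move=> QQ; apply/row_matrixP => i; rewrite row_mul !rowK -gs_mul//.
by congr gs; apply/funext => k; rewrite /edges rigidB.
Qed.

Lemma frame_map_rigid P Q b x : Q *m Q^T = 1%:M ->
  frame_map (fun i => rigid Q b (P i)) x = rigid Q b (frame_map P x).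
Proof. by move=> QQ; rewrite /frame_map frame_rigid// rigid_comp. Qed.

Lemma nondegenerate_rigid P Q b : Q *m Q^T = 1%:M ->
  nondegenerate (fun i => rigid Q b (P i)) <-> nondegenerate P.
Proof.
move=> QQ; rewrite /nondegenerate frame_rigid//.
by rewrite trmx_mul mulmxA -(mulmxA (frame P)) QQ mulmx1.
Qed.

(** Orthogonality being automatic, only a zero vector can spoil a frame. *)
Lemma nondegenerate_neq0 P : (forall i : 'I_N, gs (edges P) i != 0) ->
  nondegenerate P.
Proof.
move=> h; apply/matrixP => i j; rewrite [RHS]mxE.
have -> : (frame P *m (frame P)^T) i j = dot (gs (edges P) i) (gs (edges P) j).
  by rewrite dotE mxE; apply: eq_bigr => k _; rewrite !mxE.
have [->|] := eqVneq i j; first exact: gs_unit.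
rewrite -val_eqE neq_ltn => /orP[|] ij; last exact: gs_orthogonal.
by rewrite dotC; exact: gs_orthogonal.
Qed.

(** Points whose frame is the identity. *)
Definition corners (i : 'I_N.+1) : 'rV[R]_N :=
  if unlift ord0 i is Some j then delta_mx 0 j else 0.

Lemma edges_corners (i : 'I_N) : edges corners i = delta_mx 0 i.
Proof.
rewrite /edges /corners unlift_none subr0 (_ : inord _ = lift ord0 i) ?liftK//.
by apply/val_inj; rewrite /= inordK// ltnS.
Qed.

Lemma edges_corners0 i : (N <= i)%N -> edges corners i = 0.
Proof.
move=> Ni; rewrite /edges (_ : inord _ = ord0) ?subrr//.
by apply/val_inj; rewrite /inord /insubd insubN//= -leqNgt.
Qed.

Lemma dot_delta (i j : 'I_N) :
  dot (delta_mx 0 i) (delta_mx 0 j : 'rV[R]_N) = (i == j)%:R.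
Proof.
rewrite dotE (bigD1 j)//= !mxE !eqxx mulr1 eq_sym big1 ?addr0// => k kj.
by rewrite !mxE (negbTE kj) mulr0.
Qed.

Lemma dot_edges_corners i j :
  dot (edges corners i) (edges corners j) = ((i == j) && (i < N)%N)%:R.
Proof.
have [iN|iN] := ltnP i N; last first.
  by rewrite edges_corners0// andbF -(scale0r 0) dotZl mul0r.
have [jN|jN] := ltnP j N; last first.
  rewrite (edges_corners0 jN) dotC -(scale0r 0) dotZl mul0r.
  by rewrite ltn_eqF// (leq_trans iN).
by rewrite (edges_corners (Ordinal iN)) (edges_corners (Ordinal jN)) dot_delta andbT.
Qed.

Lemma cvg_frame (T : Type) (F : set_system T) {FF : ProperFilter F}
    (P : T -> 'I_N.+1 -> 'rV[R]_N) (i c : 'I_N) :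
  (forall k c, P t k 0 c @[t --> F] --> corners k 0 c) ->
  frame (P t) i c @[t --> F] --> ((i == c)%:R : R).
Proof.
move=> rc.
have cv k e : edges (P t) k 0 e @[t --> F] --> edges corners k 0 e.
  by rewrite edgesE; under eq_fun do rewrite edgesE; exact: cvgB.
have -> : (i == c)%:R = edges corners i 0 c :> R.
  by rewrite edges_corners mxE eqxx eq_sym.
under eq_fun do rewrite mxE.
apply: cvg_gs => //.
  by move=> k ki; rewrite dot_edges_corners eqxx (leq_ltn_trans ki).
by move=> k k' kk'; rewrite dot_edges_corners (negbTE kk').
Qed.

Lemma frame_near_corners (eta : R) : 0 < eta ->
  exists2 zeta : R, 0 < zeta & forall P,
    (forall i, enorm (P i - corners i) < zeta) ->
    nondegenerate P /\ forall i j, `|frame P i j - (i == j)%:R| < eta.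
Proof.
move=> eta0.
pose PM (A : 'M[R]_(N.+1, N)) i := row i A.
pose C : 'M[R]_(N.+1, N) := \matrix_i corners i.
have cg (i c : 'I_N) : frame (PM A) i c @[A --> nbhs C] --> ((i == c)%:R : R).
  apply: (@cvg_frame _ (nbhs C) (nbhs_pfilter C) PM) => k {}c.
  rewrite (_ : corners k 0 c = C k c); last by rewrite mxE.
  under eq_fun do rewrite mxE.
  exact: (@coord_continuous R _ _ k c C).
pose e := Num.min eta 1.
have e0 : 0 < e by rewrite lt_min eta0 ltr01.
have hc i c : \forall A \near nbhs C, `|frame (PM A) i c - (i == c)%:R| < e.
  by have /cvgrPdist_lt/(_ _ e0) := cg i c; apply: filterS => A; rewrite distrC.
have : \forall A \near nbhs C, forall i c, `|frame (PM A) i c - (i == c)%:R| < e.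
  apply: (filter_forall (f := fun i A => forall c, _)) => i.
  exact: (filter_forall (f := fun c A => _)).
move=> /nbhs_ballP [zeta zeta0 h]; exists zeta => // P hP.
have {}h i c : `|frame P i c - (i == c)%:R| < e.
  have -> : P = PM (\matrix_i P i) by apply/funext => k; rewrite /PM rowK.
  apply: h; split=> // k l; rewrite !mxE /ball /= distrC.
  by apply: le_lt_trans (hP k); apply: le_trans (coord_le_enorm _ l); rewrite !mxE.
split=> [|i c]; last by apply: lt_le_trans (h i c) _; rewrite ge_min lexx.
apply: nondegenerate_neq0 => i; apply/eqP => g0.
have := h i i; rewrite mxE g0 mxE eqxx sub0r normrN1.
by rewrite lt_min ltxx andbF.
Qed.

End Frame.

(** * Exceptional sets for finitely many independent points *)

Section Measures.
Context {R : realType}.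

Lemma sigma_finite_measureP d (T : measurableType d)
    (mu : {measure set T -> \bar R}) : sigma_finite setT mu ->
  exists m : {sigma_finite_measure set T -> \bar R}, m = mu :> (set T -> \bar R).
Proof.
move=> h.
pose H1 := isSFinite.Build _ T R mu (sfinite_measure_sigma_finite h).
pose H2 := isSigmaFinite.Build _ T R mu h.
by exists (HB.pack_for {sigma_finite_measure set T -> \bar R} (Measure.sort mu) H1 H2).
Qed.

(** Both sides of Tonelli's formula vanish, so almost all sections in the other
    direction are null. *)
Lemma null_sections d1 d2 (T1 : measurableType d1) (T2 : measurableType d2)
    (m1 : {sigma_finite_measure set T1 -> \bar R})
    (m2 : {sigma_finite_measure set T2 -> \bar R}) (A : set (T1 * T2)) :
  measurable A -> (forall x, m2 (xsection A x) = 0%E) ->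
  m2 [set y | m1 (ysection A y) != 0%E] = 0%E.
Proof.
move=> mA A0.
have := indic_fubini_tonelli m1 m2 mA.
rewrite indic_fubini_tonelli_FE// indic_fubini_tonelli_GE//.
rewrite [LHS](_ : _ = 0%E); last first.
  by rewrite integral0_eq// => x _; exact: A0.
move=> /esym h.
have mf := measurable_fun_ysection m1 mA.
have /(ae_eq_integral_abs m2 measurableT mf) : (\int[m2]_y `|(m1 \o ysection A) y| = 0)%E.
  by rewrite -[RHS]h; apply: eq_integral => y _; rewrite gee0_abs.
move=> ae0; apply: (measure_negligible (mu := m2)).
  by rewrite -[X in measurable X]setTI; exact: emeasurable_neq.
apply: negligibleS ae0 => y /= /eqP y0; apply: contra_not y0; exact.
Qed.

Lemma finite_null_avoid d (X : measurableType d) (m : {measure set X -> \bar R})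
    (S : finType) (A : S -> set X) (G : set X) :
  (forall s, measurable (A s)) -> (forall s, m (A s) = 0%E) ->
  measurable G -> m G != 0%E -> exists2 x, G x & forall s, ~ A s x.
Proof.
move=> mA A0 mG G0; apply: contrapT => h.
have n : m.-negligible (\big[setU/set0]_s A s).
  elim/big_ind : _ => [||s _]; first exact: negligible_set0.
    by move=> B C; exact: negligibleU.
  by exists (A s); split; [exact: mA|exact: A0|].
move/eqP : G0; apply; apply: (measure_negligible (mu := m)) => //.
apply: negligibleS n => x Gx.
have [s As] : exists s, A s x.
  by apply: contrapT => /forallNP h'; apply: h; exists x.
by rewrite -bigcup_seq; exists s => //=; exact: mem_index_enum.
Qed.

End Measures.

Section Tuples.
Context {R : realType} d (X : measurableType d) (n : nat).
Variable lam : {sigma_finite_measure set X -> \bar R}.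
Implicit Types (w : n.-tuple X) (A : set (n.-tuple X)).

Definition upd w (j : 'I_n) (x : X) : n.-tuple X :=
  [tuple if i == j then x else tnth w i | i < n].

Lemma tnth_upd w j x i : tnth (upd w j x) i = if i == j then x else tnth w i.
Proof. by rewrite tnth_mktuple. Qed.

Definition erase (j : 'I_n) A : set (n.-tuple X) :=
  [set w | lam [set x | A (upd w j x)] != 0%E].

(** That [bad] fails for all coordinates is the nullity of [A] for the product
    measure, expressed by iterated integration: this form only needs Fubini for
    two factors, and lends itself to choosing the coordinates successively. *)
Definition bad (s : seq 'I_n) A := foldr erase A s.

Lemma bad_ext s A w w' : (forall i, i \notin s -> tnth w i = tnth w' i) ->
  bad s A w = bad s A w'.
Proof.
elim: s w w' => [|j s IH] w w' h /=.
  by congr A; apply: eq_from_tnth => i; exact: h.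
rewrite /erase /=; congr (is_true (lam _ != _)); apply/funext => x /=.
apply: IH => i iN; rewrite !tnth_upd; case: eqVneq => // ij.
by apply: h; rewrite inE negb_or ij.
Qed.

Section Sections.
Context d' (Y : measurableType d').

Let g j : (n.-tuple X * Y) * X -> n.-tuple X * Y :=
  fun p => (upd p.1.1 j p.2, p.1.2).

Let mg j : measurable_fun setT (g j).
Proof.
apply: measurable_fun_pair; last exact: measurableT_comp.
apply/measurable_fun_tnthP => i.
rewrite (_ : _ \o _ = fun p : (n.-tuple X * Y) * X =>
  if i == j then p.2 else tnth p.1.1 i); last first.
  by apply/funext => p /=; rewrite tnth_upd.
case: eqVneq => _; first exact: measurable_snd.
apply: (measurableT_comp (f := fun w : n.-tuple X => tnth w i)).
  exact: measurable_tnth.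
exact: measurableT_comp.
Qed.

Lemma measurable_erase j (E : set (n.-tuple X * Y)) : measurable E ->
  measurable [set p : n.-tuple X * Y | erase j [set w | E (w, p.2)] p.1].
Proof.
move=> mE.
have mE' : measurable (g j @^-1` E) by rewrite -[X in measurable X]setTI; exact: mg.
have := measurable_fun_xsection lam mE'.
move=> /(emeasurable_neq measurableT (f := _)) /(_ 0%E) /=.
rewrite setTI; congr measurable; apply/funext => -[w y] /=.
by rewrite /erase /=; congr (is_true (lam _ != _)); apply/funext => x; rewrite xsectionE.
Qed.

Lemma measurable_bad s (E : set (n.-tuple X * Y)) : measurable E ->
  measurable [set p : n.-tuple X * Y | bad s [set w | E (w, p.2)] p.1].
Proof.
move=> mE; elim: s => [|j s IH] /=; last exact: measurable_erase IH.
by rewrite (_ : [set _ | _] = E)//; apply/funext => -[].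
Qed.

Lemma erase_null (mu : {sigma_finite_measure set Y -> \bar R}) j
    (E : set (n.-tuple X * Y)) : measurable E ->
  (forall w, mu [set y | E (w, y)] = 0%E) ->
  forall w, mu [set y | erase j [set w | E (w, y)] w] = 0%E.
Proof.
move=> mE E0 w.
pose A : set (X * Y) := [set p | E (upd w j p.1, p.2)].
have mA : measurable A.
  pose i (p : X * Y) := ((w, p.2), p.1).
  have mi : measurable_fun setT i.
    by do 2 apply: measurable_fun_pair => //.
  have mgi := measurableT_comp (mg j) mi.
  by rewrite -[X in measurable X]setTI; exact: mgi.
have := @null_sections _ _ _ _ _ lam mu A mA.
have h x : mu (xsection A x) = 0%E.
  by rewrite -[RHS](E0 (upd w j x)) xsectionE.
move=> /(_ h) <-; congr (mu _); apply/funext => y /=.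
by rewrite /erase /= ysectionE.
Qed.

(** By Fubini in one coordinate at a time, erasing a coordinate keeps the
    sections in y null. When all coordinates are erased, the dependence on the
    tuple is gone, so a single y outside the null set serves all tuples. *)
Lemma exists_not_bad (mu : {sigma_finite_measure set Y -> \bar R})
    (E : set (n.-tuple X * Y)) : measurable E ->
  mu setT != 0%E -> (forall w, mu [set y | E (w, y)] = 0%E) -> X ->
  exists y, forall w, ~ bad (enum 'I_n) [set w | E (w, y)] w.
Proof.
move=> mE mu0 E0 x0.
have b0 s w : mu [set y | bad s [set w | E (w, y)] w] = 0%E.
  elim: s w => [|j s IH] w; first exact: (E0 w).
  exact: (erase_null j (measurable_bad s mE) IH w).
pose w0 := [tuple x0 | i < n].
have [y hy] : exists y, ~ bad (enum 'I_n) [set w | E (w, y)] w0.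
  apply: contrapT => /forallNP h; move/eqP: mu0; apply.
  rewrite -[RHS](b0 (enum 'I_n) w0); congr (mu _); apply/seteqP; split=> // y _ /=.
  exact: contrapT (h y).
exists y => w; rewrite (_ : bad _ _ w = bad (enum 'I_n) [set w | E (w, y)] w0)//.
by apply: bad_ext => i; rewrite mem_enum.
Qed.

End Sections.

Lemma measurable_bad_set s A : measurable A -> measurable (bad s A).
Proof.
move=> mA; have [w|noT] := pselect (exists w : n.-tuple X, True); last first.
  rewrite (_ : bad s A = set0)//; apply/seteqP; split=> // w _.
  by apply: noT; exists w.
case: w => w _.
have mE : measurable (A `*` [set: n.-tuple X]) by exact: measurableX.
have := measurable_ysection w (measurable_bad s mE).
rewrite ysectionE /=; congr (measurable (bad s _)).
by apply/funext => v /=; rewrite andB.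
Qed.

Lemma measurable_slice A w j : measurable A -> measurable [set x | A (upd w j x)].
Proof.
move=> mA; rewrite -[X in measurable X]setTI.
suff mu : measurable_fun setT (upd w j) by exact: mu.
apply/measurable_fun_tnthP => i.
rewrite (_ : _ \o _ = fun x => if i == j then x else tnth w i); last first.
  by apply/funext => x /=; rewrite tnth_upd.
by case: eqVneq => _; [exact: measurable_id|exact: measurable_cst].
Qed.

(** Each successive integration is unchanged by the substitution x |-> h x. *)
Lemma bad_map (h : X -> X) s A w :
  (forall B, measurable B -> lam (h @^-1` B) = lam B) -> measurable A ->
  bad s [set w | A (map_tuple h w)] w = bad s A (map_tuple h w).
Proof.
move=> hl mA; elim: s w => [//|j s IH] w /=.
rewrite /erase /=; have <- := hl [set x | bad s A (upd (map_tuple h w) j x)]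
  (measurable_slice _ _ (measurable_bad_set s mA)).
congr (is_true (lam _ != _)); apply/funext => x /=; rewrite IH; congr (bad s A).
apply: eq_from_tnth => i; rewrite tnth_map !tnth_upd tnth_map.
by case: eqVneq.
Qed.

(** The coordinates are chosen one after the other: at each step the values to
    avoid form a null set, which cannot contain a set of positive measure. *)
Lemma avoid_bad (S : finType) (A : S -> set (n.-tuple X)) (G : 'I_n -> set X) s w :
  (forall i, measurable (A i)) ->
  (forall j, measurable (G j)) -> (forall j, lam (G j) != 0%E) ->
  uniq s -> (forall i, ~ bad s (A i) w) ->
  exists w', [/\ forall i, ~ A i w', forall j, j \in s -> G j (tnth w' j) &
    forall j, j \notin s -> tnth w' j = tnth w j].
Proof.
move=> mA mG G0; elim: s w => [|j s IH] w /=; first by exists w.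
move=> /andP [js us] hw.
have mAx i : measurable [set x | bad s (A i) (upd w j x)].
  exact: measurable_slice (measurable_bad_set s (mA i)).
have Ax0 i : lam [set x | bad s (A i) (upd w j x)] = 0%E.
  by apply/eqP; apply/negPn/negP; exact: hw.
have [x Gx hx] := finite_null_avoid mAx Ax0 (mG j) (G0 j).
have [w' [w'A w'G w'w]] := IH (upd w j x) us hx.
exists w'; split=> // i; rewrite inE.
  move=> /orP [/eqP ->|]; last exact: w'G.
  by rewrite w'w// tnth_upd eqxx.
by rewrite negb_or => /andP [ij /w'w ->]; rewrite tnth_upd (negbTE ij).
Qed.

End Tuples.

(** * Null sets of planes and random rigid motions *)

Section Grassmannian.
Context {R : realType} {N : nat}.
Local Notation G k := (affine_grassmannian R (N := N) k).
Implicit Types (k : 'I_N.+1) (g : 'rV[R]_N -> 'rV[R]_N).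

Lemma image_cancel (T U : Type) (f : T -> U) (g : U -> T) (A : set T) :
  cancel f g -> g @` (f @` A) = A.
Proof.
by move=> fK; rewrite image_comp (_ : g \o f = id) ?image_id//; apply/funext.
Qed.

Lemma plane_eq k (L1 L2 : plane R k) :
  plane_set L1 = plane_set L2 -> L1 = L2.
Proof.
case: L1 L2 => [L1 h1] [L2 h2] /= e; case: L2 / e h2 => h2.
by rewrite (Prop_irrelevance h1 h2).
Qed.

Definition plane_map k g (hg : rigid_transformation g) (L : G k) : G k :=
  Plane (is_plane_rigid hg (plane_setP L)).

Lemma plane_map_K k g f (hg : rigid_transformation g)
    (hf : rigid_transformation f) : cancel g f ->
  cancel (@plane_map k g hg) (plane_map hf).
Proof.
by move=> gK L; apply: plane_eq; exact: image_cancel.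
Qed.

Lemma plane_map_preimage k Q b (QQ : Q *m Q^T = 1%:M) (B : set (G k)) :
  plane_map (rigidP b QQ) @^-1` B = plane_image (rigid_inv Q b) B.
Proof.
have K1 := @plane_map_K k _ _ (rigidP b QQ) (rigid_inv_rigid b QQ) (rigidK b QQ).
have K2 := @plane_map_K k _ _ (rigid_inv_rigid b QQ) (rigidP b QQ) (rigid_invK b QQ).
apply/seteqP; split=> [L /= BL|L /= [L0 BL0 LL0]].
  by exists (plane_map (rigidP b QQ) L) => //; rewrite -{1}(K1 L).
by rewrite (_ : L = plane_map (rigid_inv_rigid b QQ) L0) ?K2//; exact: plane_eq.
Qed.

(** ** Points *)

Definition plane_point (x : G ord0) : 'rV[R]_N := get (plane_set x).

Lemma pointE (x : G ord0) : plane_set x = [set plane_point x].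
Proof.
have /is_planeP [p [M [_ e]]] := plane_setP x.
have e' : plane_set x = [set p].
  rewrite e; apply/seteqP; split=> [_ [u _ <-] /=|_ ->].
    by rewrite (thinmx0 u) mul0mx addr0.
  by exists 0 => //; rewrite mul0mx addr0.
suff -> : plane_point x = p by [].
have : plane_set x (plane_point x) by apply: (getI (x := p)); rewrite e'.
by rewrite e'.
Qed.

Lemma point_map g (hg : rigid_transformation g) (x : G ord0) :
  plane_point (plane_map hg x) = g (plane_point x).
Proof.
have := pointE (plane_map hg x); rewrite /= pointE image_set1 => e.
by have : [set g (plane_point x)] (g (plane_point x)) by []; rewrite e.
Qed.

(** ** Borel sets of planes *)

Definition eball (c : 'rV[R]_N) (r : R) : set 'rV[R]_N := [set x | enorm (x - c) < r].

Lemma rat_approx (x : 'rV[R]_N) (e : R) : 0 < e ->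
  exists q : 'rV[rat]_N, enorm (x - map_mx ratr q) < e.
Proof.
move=> e0; pose dl := e / (Num.sqrt N%:R + 1).
have sN : 0 < Num.sqrt N%:R + 1 :> R by rewrite ltr_wpDl// sqrtr_ge0.
have dl0 : 0 < dl by rewrite divr_gt0.
have h i : exists q : rat, `|x 0 i - ratr q| < dl.
  have /rat_in_itvoo [q] : x 0 i - dl < x 0 i + dl by lra.
  by rewrite in_itv /= => /andP [h1 h2]; exists q; rewrite ltr_distlC; apply/andP; split; lra.
have [q hq] := choice h.
exists (\row_i q i); apply: (@le_lt_trans _ _ (Num.sqrt N%:R * dl)).
  by apply: enorm_le_coord => [|i]; [exact: ltW|rewrite !mxE; exact/ltW/hq].
by rewrite /dl mulrA ltr_pdivrMr// mulrC ltr_pM2l// ltrDl.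
Qed.

Lemma open_eball c r : open (eball c r).
Proof.
rewrite openE => x; rewrite /eball /= => xr.
pose e := (r - enorm (x - c)) / (Num.sqrt N%:R + 1).
have sN : 0 < Num.sqrt N%:R + 1 :> R by rewrite ltr_wpDl// sqrtr_ge0.
have e0 : 0 < e by rewrite divr_gt0// subr_gt0.
apply/nbhs_ballP; exists e => //= y [_ xy]; rewrite /eball /=.
apply: le_lt_trans (enormB _ x _) _; rewrite -ltrBrDr.
apply: (@le_lt_trans _ _ (Num.sqrt N%:R * e)).
  apply: enorm_le_coord => [|i]; first exact: ltW.
  by have := xy 0 i; rewrite /ball /= !mxE distrC => /ltW.
by rewrite /e mulrA ltr_pdivrMr// mulrC ltr_pM2l ?subr_gt0// ltrDl.
Qed.

Lemma open_eball_sub (U : set 'rV[R]_N) x : open U -> U x ->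
  exists2 e, 0 < e & eball x e `<=` U.
Proof.
rewrite openE => /[apply] /nbhs_ballP [e e0 h]; exists e => // y xy.
apply: h; split=> // i j; rewrite /ball /= distrC ord1.
by apply: le_lt_trans xy; rewrite (le_trans _ (coord_le_enorm _ j))// !mxE.
Qed.

Lemma measurable_hitting k (U : set 'rV[R]_N) : open U ->
  measurable ([set L : G k | plane_set L `&` U !=set0] : set (G k)).
Proof. by move=> oU; apply: sub_sigma_algebra; exists U. Qed.

Lemma hitting_eball (x : G ord0) c r :
  plane_set x `&` eball c r !=set0 <-> enorm (plane_point x - c) < r.
Proof.
rewrite pointE; split=> [[y [/= -> //]]|h].
by exists (plane_point x).
Qed.

Lemma measurable_point c : measurable_fun [set: G ord0] (fun x => plane_point x 0 c).
Proof.
apply: (measurability _ (RGenInftyO.measurableE R)) => //.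
move=> _ [_ [a ->] <-]; rewrite setTI.
rewrite (_ : _ @^-1` _ =
    [set x : G ord0 | plane_set x `&` [set y | y 0 c < a] !=set0]).
  apply: measurable_hitting.
  apply: (@open_comp _ _ (fun y : 'rV[R]_N => y 0 c) `]-oo, a[%classic).
    by move=> y _; exact: coord_continuous.
  exact: interval_open.
apply/seteqP; split=> x /=; rewrite in_itv /= pointE.
  by move=> h; exists (plane_point x).
by move=> [y [/= ->]].
Qed.

End Grassmannian.

Section Exceptional.
Context {R : realType} {N : nat}.
Local Notation G k := (affine_grassmannian R (N := N) k).
Local Notation tup := (N.+1.-tuple (G ord0)).
Implicit Types (k : 'I_N.+1) (w : tup).

Definition points w i := plane_point (tnth w i).

(** The pairs of a frame g and a plane L such that g^-1 moves L into B. Writing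
    it as L in g(B) makes the section at g an image under a rigid motion. *)
Definition exceptional k (B : set (G k)) : set (tup * G k) :=
  [set p | nondegenerate (points p.1) /\
           plane_image (frame_map (points p.1)) B p.2].

Lemma measurable_points i c : measurable_fun setT (fun w => points w i 0 c).
Proof.
apply: (measurableT_comp (measurable_point c)); exact: measurable_tnth.
Qed.

Lemma measurable_frame i j : measurable_fun setT (fun w => frame (points w) i j).
Proof.
under eq_fun do rewrite mxE; apply: measurable_gs => {}i c.
under eq_fun do rewrite edgesE.
by apply: measurable_funB; exact: measurable_points.
Qed.

Lemma measurable_frame_map x c :
  measurable_fun setT (fun w => frame_map (points w) x 0 c).
Proof.
under eq_fun do rewrite !mxE.
apply: measurable_funD; last exact: measurable_points.
by apply: measurable_sum => i; apply: measurable_funM => //; exact: measurable_frame.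
Qed.

Lemma measurable_nondegenerate : measurable [set w | nondegenerate (points w)].
Proof.
rewrite (_ : [set _ | _] = \bigcap_(ij : 'I_N * 'I_N)
    [set w | (frame (points w) *m (frame (points w))^T) ij.1 ij.2 = (ij.1 == ij.2)%:R]).
  apply: fin_bigcap_measurable; first exact: finite_finset.
  move=> [i j] _ /=; under eq_set do rewrite mxE.
  have mf : measurable_fun setT (fun w => \sum_k frame (points w) i k * (frame (points w))^T k j).
    apply: measurable_sum => k; under eq_fun do rewrite [_^T _ _]mxE.
    by apply: measurable_funM; exact: measurable_frame.
  by have := mf measurableT _ (measurable_set1 (i == j)%:R); rewrite setTI.
apply/seteqP; split=> [w h [i j] _ /=|w h].
  by rewrite h mxE.
by apply/matrixP => i j; rewrite [RHS]mxE; exact: (h (i, j)).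
Qed.

Let measurable_near_rect k c s (q : 'rV[R]_N) (rho : R) :
  measurable [set p : tup * G k | enorm (frame_map (points p.1) c - q) + rho < s
    /\ plane_set p.2 `&` eball q rho !=set0].
Proof.
rewrite (_ : [set _ | _] = [set w | enorm (frame_map (points w) c - q) + rho < s] `*`
   [set L : G k | plane_set L `&` eball q rho !=set0]); last by [].
apply: measurableX; last by apply: measurable_hitting; exact: open_eball.
have mf : measurable_fun setT (fun w => enorm (frame_map (points w) c - q) + rho).
  apply: measurable_funD => //; apply: measurable_enorm => i.
  under eq_fun do rewrite mxE; apply: measurable_funD => //.
  exact: measurable_frame_map.
have := mf measurableT `]-oo, s[%classic (measurable_itv _).
by rewrite setTI; congr measurable; apply/seteqP; split=> w /=; rewrite in_itv.
Qed.

(** Writing U as a union of rational balls of centre c and radius s, the plane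
    meets the moved ball iff it meets a rational ball of centre q and radius r
    with |g c - q| + r < s. In this condition the frame and the plane are
    separated, so that the set is a countable union of measurable rectangles. *)
Lemma exceptional_hitting k (U : set 'rV[R]_N) : open U ->
  exceptional [set L : G k | plane_set L `&` U !=set0] =
  [set p | nondegenerate (points p.1)] `&`
  \bigcup_(cs in [set cs : 'rV[rat]_N * rat | eball (map_mx ratr cs.1) (ratr cs.2) `<=` U])
  \bigcup_(qr in [set: 'rV[rat]_N * rat])
   [set p : tup * G k |
       enorm (frame_map (points p.1) (map_mx ratr cs.1) - map_mx ratr qr.1) + ratr qr.2
       < ratr cs.2 /\ plane_set p.2 `&` eball (map_mx ratr qr.1) (ratr qr.2) !=set0].
Proof.
move=> oU; apply/seteqP; split=> -[w L] /= [nd]; rewrite /= in nd.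
  move=> [L0 [y [L0y Uy]] LE]; split=> //.
  have [e e0 yU] := open_eball_sub oU Uy.
  have /rat_in_itvoo [s] : e / 4 < e / 2 by lra.
  rewrite in_itv /= => /andP [s1 s2].
  have [c yc] := @rat_approx R N y (ratr s) ltac:(lra).
  exists (c, s) => /=.
    move=> z zc; apply: yU; rewrite /eball /= in zc *.
    apply: le_lt_trans (enormB _ (map_mx ratr c) _) _.
    by rewrite (enorm_distC _ y); lra.
  have /rat_in_itvoo [r] : 0 < (ratr s - enorm (y - map_mx ratr c)) / 2 :> R by lra.
  rewrite in_itv /= => /andP [r0 r1].
  pose x := frame_map (points w) y.
  have [q xq] := rat_approx x r0.
  exists (q, r) => //=; split.
    apply: (@le_lt_trans _ _ (enorm (y - map_mx ratr c) + ratr r + ratr r)); last by lra.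
    rewrite lerD2r (le_trans (enormB _ x _))// lerD//; last exact: ltW.
    by rewrite enorm_rigid// enorm_distC.
  by exists x; split => //; rewrite LE; exists y.
move=> [[c s] /= csU [[q r] _ /= [near [x [Lx xq]]]]]; split=> //.
rewrite /eball /= in xq.
have rK := rigid_invK (points w ord0) nd.
exists (plane_map (rigid_inv_rigid (points w ord0) nd) L); last first.
  by apply/esym/image_cancel.
exists (rigid_inv (frame (points w)) (points w ord0) x) => /=.
split; first by exists x.
apply: csU; rewrite /eball /= -(enorm_rigid (points w ord0) _ _ nd) rK.
apply: le_lt_trans (enormB _ (map_mx ratr q) _) _.
move: near xq; rewrite /frame_map (enorm_distC (map_mx ratr q)); lra.
Qed.

(** Moving by the frame commutes with complements and unions of sets of planes,
    so it is enough to treat the generators of the sigma-algebra. *)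
Lemma measurable_exceptional k (B : set (G k)) :
  measurable B -> measurable (exceptional B).
Proof.
have mND : measurable [set p : tup * G k | nondegenerate (points p.1)].
  rewrite (_ : [set _ | _] = [set w | nondegenerate (points w)] `*` setT).
    by apply: measurableX => //; exact: measurable_nondegenerate.
  by apply/seteqP; split=> -[w L] //= [].
move: B; apply: smallest_sub.
  split=> [|B mB|B mB] /=.
  - rewrite (_ : exceptional set0 = set0)//.
    by apply/seteqP; split=> // -[w L] [_ []].
  - rewrite (_ : exceptional (setT `\` B) =
      [set p | nondegenerate (points p.1)] `\` exceptional B).
      exact: measurableD.
    apply/seteqP; split=> -[w L] /= [nd].
      move=> [L0 [_ nB] LE]; split=> // -[_ [L1 B1]] /=; rewrite LE => e.
      apply: nB; rewrite (_ : L0 = L1)//; apply: plane_eq.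
      have fK := rigidK (points w ord0) nd.
      by rewrite -[LHS](image_cancel _ fK) -[RHS](image_cancel _ fK); congr image.
    move=> nE; split=> //.
    exists (plane_map (rigid_inv_rigid (points w ord0) nd) L).
      split=> // BL; apply: nE; split=> //.
      eexists; first exact: BL.
      by apply/esym/image_cancel; exact: rigid_invK.
    by apply/esym/image_cancel; exact: rigid_invK.
  - rewrite (_ : exceptional (\bigcup_i B i) = \bigcup_i exceptional (B i)).
      exact: bigcupT_measurable.
    apply/seteqP; split=> -[w L] /=.
      by move=> [nd [L0 [i _ BL0] LE]]; exists i => //; split=> //; exists L0.
    by move=> [i _ [nd [L0 BL0 LE]]]; split=> //; exists L0 => //; exists i.
move=> _ [U oU <-] /=; rewrite exceptional_hitting//.
apply: measurableI => //.
rewrite bigcup_mkcond; apply: countable_bigcupT_measurable => [|cs]; first exact: countableP.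
case: ifP => // _.
apply: countable_bigcupT_measurable => [|qr]; first exact: countableP.
exact: measurable_near_rect.
Qed.

Lemma exceptional_map k (B : set (G k)) Q b (QQ : Q *m Q^T = 1%:M) w L :
  exceptional B (map_tuple (plane_map (rigidP b QQ)) w, plane_map (rigidP b QQ) L)
  <-> exceptional B (w, L).
Proof.
have e : points (map_tuple (plane_map (rigidP b QQ)) w) = fun i => rigid Q b (points w i).
  by apply/funext => i; rewrite /points tnth_map point_map.
rewrite /exceptional /= e nondegenerate_rigid//.
have ef : frame_map (fun i => rigid Q b (points w i)) = rigid Q b \o frame_map (points w).
  by apply/funext => x /=; rewrite frame_map_rigid.
rewrite ef /plane_image /=.
split=> -[nd [L0 BL0 LE]]; split=> //; exists L0 => //; last first.
  by rewrite LE image_comp.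
have fK := rigidK b QQ.
rewrite -[LHS](image_cancel _ fK) -[RHS](image_cancel _ fK).
by congr image; rewrite LE image_comp.
Qed.

End Exceptional.

Section Generic.
Context {R : realType} {N : nat}.
Local Notation G k := (affine_grassmannian R (N := N) k).
Implicit Types (k : 'I_N.+1).

Lemma uniform_sigma_finite k (mu : {measure set (G k) -> \bar R}) :
  uniform_measure mu -> sigma_finite setT mu.
Proof.
move=> [_ fin _].
exists (fun i => [set L : G k | plane_set L `&` [set x | enorm x < i%:R] !=set0]).
  apply/seteqP; split=> // L _.
  have [p [W [_ e]]] := plane_setP L.
  exists (Num.truncn (enorm p)).+1 => //=; exists p; split; last exact: truncnS_gt.
  by rewrite e; exists 0 => /=; rewrite ?mem0v ?addr0.
move=> i; split; last exact: fin.
rewrite (_ : [set x | _] = eball 0 i%:R); last first.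
  by apply/seteqP; split=> x; rewrite /eball /= subr0.
by apply: measurable_hitting; exact: open_eball.
Qed.

Lemma uniform_plane_map_preimage k (mu : {measure set (G k) -> \bar R}) Q b
    (QQ : Q *m Q^T = 1%:M) (B : set (G k)) : uniform_measure mu ->
  measurable B -> mu (plane_map (rigidP b QQ) @^-1` B) = mu B.
Proof.
move=> [_ _ inv] mB; rewrite plane_map_preimage inv//.
exact: rigid_inv_rigid.
Qed.

Definition point_ball (c : 'rV[R]_N) (r : R) : set (G ord0) :=
  [set x | enorm (plane_point x - c) < r].

Lemma point_ballE c r :
  point_ball c r = [set x | plane_set x `&` eball c r !=set0].
Proof. by apply/seteqP; split=> x /hitting_eball. Qed.

Lemma measurable_point_ball c r : measurable (point_ball c r).
Proof. by rewrite point_ballE; apply: measurable_hitting; exact: open_eball. Qed.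

(** Balls with rational centres cover space and are translates of each other. *)
Lemma point_ball_neq0 (mu : {measure set (G ord0) -> \bar R}) c r :
  uniform_measure mu -> 0 < r -> mu (point_ball c r) != 0%E.
Proof.
move=> umu r0; apply/eqP => m0; have [mu0 _ _] := umu.
have mq q : mu (point_ball q r) = 0%E.
  have QQ : (1%:M : 'M[R]_N) *m 1%:M^T = 1%:M by rewrite trmx1 mulmx1.
  rewrite -m0 -(uniform_plane_map_preimage (q - c) QQ umu (measurable_point_ball _ _)).
  congr (mu _); apply/funext => x; rewrite /point_ball /= point_map /rigid mulmx1.
  by rewrite addrA addrAC addrK.
suff : mu setT = 0%E by move=> e; rewrite e ltxx in mu0.
apply: (measure_negligible (mu := mu)) => //.
pose F i : set (G ord0) :=
  if unpickle i is Some q then point_ball (map_mx ratr (q : 'rV[rat]_N)) r else set0.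
apply: (@negligibleS _ _ _ _ (\bigcup_i F i)).
  move=> x _; have [q hq] := rat_approx (plane_point x) r0.
  by exists (pickle q) => //; rewrite /F pickleK.
apply: negligible_bigcup => i; rewrite /F; case: unpickle => [q|].
  by exists (point_ball (map_mx ratr q) r); split=> //; exact: measurable_point_ball.
exact: negligible_set0.
Qed.

(** Some plane L1 has this property by [exists_not_bad]; a rigid motion h sends
    L1 to L, and applying h to both the plane and the points changes neither the
    exceptional pairs nor the measure on points. *)
Lemma exceptional_not_bad (lam : {sigma_finite_measure set (G ord0) -> \bar R})
    (mu0 : {measure set (G ord0) -> \bar R}) k (mu : {measure set (G k) -> \bar R})
    (B : set (G k)) (L : G k) : lam = mu0 :> (set _ -> _) ->
  uniform_measure mu0 -> uniform_measure mu -> measurable B -> mu B = 0%E ->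
  forall w, ~ bad lam (enum 'I_N.+1) [set w | exceptional B (w, L)] w.
Proof.
move=> lamE u0 umu mB B0.
have [m mE] := sigma_finite_measureP (uniform_sigma_finite umu).
have [|w||L1 hL1] := exists_not_bad lam (mu := m) (measurable_exceptional mB).
- by rewrite mE gt_eqF//; case: umu.
- have [nd|nd] := pselect (nondegenerate (points w)); last first.
    rewrite (_ : [set _ | _] = set0) ?measure0//.
    by apply/seteqP; split=> // y [].
  rewrite (_ : [set _ | _] = plane_image (frame_map (points w)) B); last first.
    by apply/seteqP; split=> y // [].
  by rewrite mE; case: umu => _ _ ->//; exact: rigidP.
- exact: point.
have [Q [b [QQ LE]]] := plane_transitive (plane_setP L1) (plane_setP L).
pose h k := @plane_map R N k _ (rigidP b QQ).
have {}LE : L = h k L1 by exact: plane_eq.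
move=> w.
pose A := [set w | exceptional B (w, L)].
have mA : measurable A.
  by have := measurable_ysection L (measurable_exceptional mB); rewrite ysectionE.
rewrite (@bad_ext _ _ _ _ _ _ A w (map_tuple (h ord0) w)); last first.
  by move=> i; rewrite mem_enum.
rewrite -(bad_map (h := h ord0)) //; last first.
  by move=> C mC; rewrite lamE uniform_plane_map_preimage.
rewrite (_ : [set _ | _] = [set w | exceptional B (w, L1)]); first exact: hL1.
apply/seteqP; split=> v; rewrite /A /= LE.
  exact: (iffLR (exceptional_map _ _ QQ _ _)).
exact: (iffRL (exceptional_map _ _ QQ _ _)).
Qed.

(** The points are drawn close to [corners], within balls of positive measure,
    which forces their frame to be close to the identity. *)
Lemma generic_rigid (mu : forall k, {measure set (G k) -> \bar R})
    (S : finType) (k : S -> 'I_N.+1) (L : forall s, G (k s))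
    (B : forall s, set (G (k s))) (eta : R) :
  (forall k, uniform_measure (mu k)) ->
  (forall s, (mu (k s)).-negligible (B s)) -> 0 < eta ->
  exists Q b, [/\ Q *m Q^T = 1%:M, forall i j, `|Q i j - (i == j)%:R| < eta,
    enorm b < eta &
    forall s (L' : G (k s)), plane_set (L s) = rigid Q b @` plane_set L' -> ~ B s L'].
Proof.
move=> umu nB eta0.
have [lam lamE] := sigma_finite_measureP (uniform_sigma_finite (umu ord0)).
pose C s := projT1 (cid (nB s)).
have hC s : [/\ measurable (C s), mu (k s) (C s) = 0%E & B s `<=` C s].
  exact: projT2 (cid (nB s)).
have [zeta zeta0 hz] := frame_near_corners (N := N) eta0.
pose r := Num.min zeta eta.
have r0 : 0 < r by rewrite lt_min zeta0.
pose A s := [set w | exceptional (C s) (w, L s)].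
have mA s : measurable (A s).
  have [mC _ _] := hC s.
  by have := measurable_ysection (L s) (measurable_exceptional mC); rewrite ysectionE.
have nb s (w : N.+1.-tuple (G ord0)) : ~ bad lam (enum 'I_N.+1) (A s) w.
  have [mC C0 _] := hC s.
  exact: (exceptional_not_bad lamE (umu ord0) (umu (k s)) mC C0).
have [||w' [wA wG _]] := avoid_bad (lam := lam) (G := fun i => point_ball (corners i) r)
    mA _ _ (enum_uniq 'I_N.+1) (fun s => nb s [tuple point | i < N.+1]).
- by move=> j; exact: measurable_point_ball.
- by move=> j; rewrite lamE; apply: point_ball_neq0.
have {}wG i : enorm (points w' i - corners i) < r by apply: wG; rewrite mem_enum.
have [nd near1] : nondegenerate (points w') /\
    forall i j, `|frame (points w') i j - (i == j)%:R| < eta.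
  by apply: hz => i; apply: lt_le_trans (wG i) _; rewrite ge_min lexx.
exists (frame (points w')), (points w' ord0); split=> //.
  have := wG ord0; rewrite /corners unlift_none subr0 => /lt_le_trans; apply.
  by rewrite ge_min lexx orbT.
move=> s L' e BL'; apply: (wA s); split=> //=; exists L' => //.
by have [_ _] := hC s; apply.
Qed.

End Generic.

(** * Nets from a coordinate grid *)

Lemma card_le_seq (T : choiceType) (A : set T) (l : seq T) :
  (forall x, A x -> x \in l) ->
  exists m, (m <= size l)%N /\ (A #= `I_m)%card.
Proof.
move=> Al; have [k Ak] : finite_set A.
  by apply: sub_finite_set (finite_seq l) => x; exact: Al.
exists k; split=> //; have [[x0 _]|A0] := pselect (A !=set0); last first.
  have A00 : A = set0 by apply/seteqP; split=> x // Ax; case: A0; exists x.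
  suff : k = 0%N by move=> ->.
  apply/card_eq_II; move: Ak; rewrite A00 II0 card_eq_sym => /card_eq_trans; apply.
  by rewrite card_eq0.
rewrite -card_le_II -(card_le_eql Ak).
apply: card_le_trans (card_image_le (nth x0 l) `I_(size l)).
apply: subset_card_le => x /Al xl; exists (index x l); last exact: nth_index.
by rewrite /= index_mem.
Qed.

Section Grid.
Context {R : realType} {N m : nat}.
Variables (V : set 'rV[R]_N) (F : 'rV[R]_N -> 'rV[R]_N) (a : 'I_m -> R).
Hypothesis cF : forall i, continuous (fun x => F x 0 i).
Local Notation flat := {ffun 'I_N -> option 'I_m}.
Implicit Types (s : flat) (x y z : 'rV[R]_N).

(** A flat of the grid is encoded by the grid values of the coordinates that are
    constant on it. *)
Definition on_flat s y := forall i h, s i = Some h -> y 0 i = a h.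

Definition codim s := #|[pred i | s i != None]|.

Definition slice s : set 'rV[R]_N := V `&` [set x | on_flat s (F x)].

(** When x lies on the grid its cell degenerates to a face. *)
Definition cell x : set 'rV[R]_N := V `&` [set y | forall i h,
  (F x 0 i <= a h -> F y 0 i <= a h) /\ (a h <= F x 0 i -> a h <= F y 0 i)].

(** Along a path in the slice, let psi be the least signed distance to the walls
    of the cell in the unassigned coordinates; the assigned ones are constant.
    If psi becomes negative it vanishes somewhere, at a point still in the cell and on
    one more wall, against the maximality of the codimension of s. *)
Lemma component_in_cell x s y z : slice s y -> cell x y ->
  (forall s' y', slice s' y' -> cell x y' -> (codim s' <= codim s)%N) ->
  path_joined (R := R) (slice s) y z -> cell x z.
Proof.
move=> sy [_ xy] smax [f [fc f0 f1 fs]].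
pose act (p : 'I_N * 'I_m * bool) := (s p.1.1 == None) &&
  (if p.2 then F x 0 p.1.1 <= a p.1.2 else a p.1.2 <= F x 0 p.1.1).
pose mg (p : 'I_N * 'I_m * bool) y :=
  if p.2 then a p.1.2 - F y 0 p.1.1 else F y 0 p.1.1 - a p.1.2.
(* The default value 1 is positive, so a vanishing psi is attained on a wall. *)
pose psi y := \big[Num.min/1]_(p | act p) mg p y.
have psic : continuous psi.
  apply: continuous_big => [|[[i h] b] _]; first exact: min_continuous.
  rewrite /mg /=; case: b => u.
    by apply: (@continuousB R R^o); [exact: cst_continuous|exact: cF].
  by apply: (@continuousB R R^o); [exact: cF|exact: cst_continuous].
have fsl t : t \in `[0, 1] -> slice s (f t) by move=> t01; apply: fs; exists t.
have cellE t : t \in `[0, 1] -> 0 <= psi (f t) -> cell x (f t).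
  move=> t01 /bigmin_geP [_ h]; have [Vt st] := fsl t t01; split=> // i k.
  case si: (s i) => [k'|]; last first.
    split=> xi.
      by have := h (i, k, true); rewrite /act /mg /= si eqxx subr_ge0; apply.
    by have := h (i, k, false); rewrite /act /mg /= si eqxx subr_ge0; apply.
  by rewrite (st _ _ si) -(sy.2 _ _ si); exact: xy.
have psi0 : 0 <= psi (f 0).
  apply/bigmin_geP; split=> // -[[i h] b]; rewrite /act /mg /= f0.
  by case: b => /andP [_ xi]; rewrite subr_ge0; apply xy.
have [psi1|psi1] := leP 0 (psi (f 1)).
  by rewrite -f1; apply: cellE => //; rewrite in_itv /= ler01 lexx.
have [||t t01 psit] := @IVT R (psi \o f) 0 1 0 ler01.
- by apply: within_continuous_comp => // u _; exact: psic.
- by rewrite /= ge_min (ltW psi1) orbT le_max psi0.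
have ct : cell x (f t) by apply: cellE => //; rewrite [psi _]psit.
have [[[i h] b] ap mt] : exists2 p, act p & mg p (f t) <= 0.
  have : psi (f t) <= 0 by rewrite [psi _]psit.
  by move=> /bigmin_leP [|//]; rewrite ler10.
have /andP [/eqP si _] := ap.
have fth : F (f t) 0 i = a h.
  have : 0 <= mg (i, h, b) (f t).
    have : 0 <= psi (f t) by rewrite [psi _]psit.
    by move=> /bigmin_geP [_]; apply.
  by move: mt; rewrite /mg /=; case: (b) => h1 h2; lra.
pose s' : flat := [ffun j => if j == i then Some h else s j].
have : (codim s' <= codim s)%N.
  apply: (smax s' (f t)) => //; have [Vt st] := fsl t t01; split=> // j k.
  by rewrite ffunE; case: eqP => [-> [<-]//|_]; exact: st.
rewrite leqNgt (_ : codim s' = (codim s).+1) ?ltnSn//.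
rewrite /codim (cardD1 i) inE ffunE eqxx /= add1n; congr _.+1.
apply: eq_card => j; rewrite !inE ffunE.
by case: eqVneq => //= ->; rewrite si.
Qed.

(** A flat of codimension at most n is given by n equations, some of them void;
    this encoding is surjective and makes the count (1 + N m) ^ n immediate. *)
Definition flat_of_tuple n (u : n.-tuple (option ('I_N * 'I_m))) : flat :=
  [ffun i => [pick h | Some (i, h) \in u]].

Lemma flat_of_tuple_onto n s : (codim s <= n)%N ->
  exists u : n.-tuple _, flat_of_tuple u = s.
Proof.
move=> sn; pose l := [seq omap (pair i) (s i) | i <- enum [pred i | s i != None]].
have sl : size (l ++ nseq (n - codim s) None) == n.
  by rewrite size_cat size_map -cardE size_nseq subnKC.
exists (Tuple sl); apply/ffunP => i; rewrite ffunE.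
have ul h : (Some (i, h) \in Tuple sl) = (s i == Some h).
  rewrite (_ : (_ \in _) = (Some (i, h) \in l ++ nseq (n - codim s) None))//.
  rewrite mem_cat mem_nseq andbF orbF.
  apply/mapP/eqP => [[j _]|si]; first by case sj : (s j) => [k|] //= [-> ->].
  by exists i; rewrite ?si// mem_enum inE si.
case: pickP => [h|nh]; first by rewrite ul => /eqP.
by case si : (s i) => [h|//]; have := nh h; rewrite ul si eqxx.
Qed.

(** The net consists of one point in each path component of each slice. *)
Lemma grid_net K n :
  (forall s, (codim s <= n)%N ->
    (path_components (R := R) (slice s) #<= `I_K)%card) ->
  (forall s, (n < codim s)%N -> slice s = set0) ->
  exists S : set 'rV[R]_N, [/\ S `<=` V,
    exists k, (k <= K * (1 + N * m) ^ n)%N /\ (S #= `I_k)%card &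
    forall x, V x -> exists2 p, S p & cell x p].
Proof.
move=> sK s0.
pose S := [set p | exists s C, [/\ (codim s <= n)%N,
  path_components (R := R) (slice s) C & p = get C]].
have refl A x : A x -> path_joined (R := R) A x x.
  move=> Ax; exists (fun=> x); split=> //; last by move=> _ [_ _ <-].
  by apply: continuous_subspaceT => t; exact: cvg_cst.
have getC s C : path_components (R := R) (slice s) C ->
    exists2 y, slice s y & path_joined (R := R) (slice s) y (get C) /\
      C = [set z | path_joined (R := R) (slice s) y z].
  move=> [y sy <-]; exists y => //; split=> //.
  have := @getI _ [set z | path_joined (R := R) (slice s) y z] y.
  by apply; apply: refl.
have sV s y z : path_joined (R := R) (slice s) y z -> slice s z.
  by move=> [f [_ _ <- h]]; apply: h; exists 1 => //=; rewrite in_itv /= ler01 lexx.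
exists S; split.
- by move=> p [s [C [_ /getC [y _ [/sV [Vp _] _]] ->]]].
- have ex (u : n.-tuple (option ('I_N * 'I_m))) : exists g : nat -> set 'rV[R]_N,
      (codim (flat_of_tuple u) <= n)%N ->
      path_components (R := R) (slice (flat_of_tuple u)) `<=` g @` `I_K.
    have [un|un] := leqP (codim (flat_of_tuple u)) n; last by exists (fun=> set0).
    by have /pcard_surjP [g gs] := sK _ un; exists g.
  have [g hg] := choice ex.
  pose l := [seq get (g u (nat_of_ord k)) |
    u <- enum {: n.-tuple (option ('I_N * 'I_m))}, k <- enum 'I_K].
  have [k [kl Sk]] : exists k, (k <= size l)%N /\ (S #= `I_k)%card.
    apply: card_le_seq => _ [s [C [sn sC ->]]].
    have [u us] := flat_of_tuple_onto sn.
    have := hg u; rewrite us => /(_ sn C sC) [k kK gC].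
    apply/allpairsP; exists (u, Ordinal kK); split; rewrite ?mem_enum//=.
    by rewrite gC.
  exists k; split=> //; apply: leq_trans kl _.
  rewrite size_allpairs -!cardE card_tuple card_option card_prod !card_ord.
  by rewrite mulnC add1n.
- move=> x Vx.
  have cx : cell x x by split.
  pose P s := `[< exists y, slice s y /\ cell x y >].
  have P0 : P [ffun=> None].
    by apply/asboolP; exists x; split=> //; split=> // i h; rewrite ffunE.
  have [s /asboolP [y [sy xy]] smax] := @arg_maxnP _ _ P codim P0.
  have {}smax s' y' : slice s' y' -> cell x y' -> (codim s' <= codim s)%N.
    by move=> s'y' xy'; apply: smax; apply/asboolP; exists y'.
  have sn : (codim s <= n)%N.
    by rewrite leqNgt; apply/negP => /s0 e; rewrite e in sy.
  pose C := [set z | path_joined (R := R) (slice s) y z].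
  have sC : path_components (R := R) (slice s) C by exists y.
  exists (get C); first by exists s, C.
  apply: (component_in_cell sy xy smax).
  by apply: (@getI _ C y); exact: refl.
Qed.

End Grid.

(** The m walls cut [-r, r] into m + 1 intervals of length w, and Y cannot be
    separated from X by a wall. *)
Lemma grid_width (R : realType) (m : nat) (r w X Y : R) : 0 < w ->
  2 * r = m.+1%:R * w -> - r <= X <= r -> - r <= Y <= r ->
  (forall h : 'I_m, (X <= - r + h.+1%:R * w -> Y <= - r + h.+1%:R * w) /\
     (- r + h.+1%:R * w <= X -> - r + h.+1%:R * w <= Y)) ->
  `|X - Y| <= w.
Proof.
move=> w0 rw /andP [X1 X2] /andP [Y1 Y2] h.
have fl Z : - r <= Z -> exists k : nat, - r + k%:R * w <= Z < - r + k.+1%:R * w.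
  move=> Z1; exists (Num.truncn ((Z + r) / w)).
  have q0 : 0 <= (Z + r) / w by rewrite divr_ge0 ?(ltW w0)//; lra.
  have /andP [] := truncn_itv q0.
  rewrite ler_pdivlMr// ltr_pdivrMr// => h1 h2; apply/andP; split; lra.
have mS k : k.+1%:R * w = k%:R * w + w by rewrite -natr1 mulrDl mul1r.
rewrite ler_distl; apply/andP; split.
- have [k /andP [k1 k2]] := fl X X1.
  have [km|mk] := ltnP k m.
    by have [/(_ (ltW k2)) + _] := h (Ordinal km); rewrite mS /=; lra.
  have : m%:R * w <= k%:R * w by rewrite ler_pM2r// ler_nat.
  by move: rw; rewrite mS; lra.
- have [k /andP [k1 k2]] := fl Y Y1.
  have [km|mk] := ltnP k m.
    have [_ h2] := h (Ordinal km); rewrite leNgt; apply/negP => lt.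
    suff : - r + k.+1%:R * w <= Y by rewrite leNgt k2.
    by apply: h2 => /=; rewrite mS; lra.
  have : m%:R * w <= k%:R * w by rewrite ler_pM2r// ler_nat.
  by move: rw; rewrite mS; lra.
Qed.

(** * Nets of regular sets *)

Section Covering.
Context {R : realType} {N : nat}.
Local Notation G k := (affine_grassmannian R (N := N) k).

Section Flats.
Context {m : nat}.
Variable a : 'I_m -> R.
Implicit Types s : {ffun 'I_N -> option 'I_m}.

Lemma codim_le s : (codim s <= N)%N.
Proof. by rewrite -[leqRHS]card_ord max_card. Qed.

(** The unassigned coordinates parametrize the flat. *)
Lemma is_plane_flat s : is_plane (N - codim s) [set y : 'rV[R]_N | on_flat a s y].
Proof.
pose J := [pred i | s i == None].
have JE : #|J| = (N - codim s)%N.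
  have -> : #|J| = #|predC [pred i | s i != None]|.
    by apply: eq_card => i; rewrite !inE negbK.
  rewrite -[LHS](addKn (codim s)); congr (_ - _)%N.
  by rewrite /codim cardC card_ord.
rewrite -JE; apply/is_planeP.
exists (\row_i if s i is Some h then a h else 0),
  (\matrix_(k < #|J|) delta_mx 0 (enum_val k)); split.
  apply/row_freeP; exists (\matrix_(k < #|J|) delta_mx 0 (enum_val k))^T.
  apply/matrixP => k l; rewrite !mxE (bigD1 (enum_val k))//= !mxE !eqxx mul1r.
  rewrite (inj_eq enum_val_inj) big1 ?addr0// => i ik.
  by rewrite !mxE (negbTE ik) mul0r.
have mulE (u : 'rV[R]_#|J|) i :
    (u *m \matrix_(k < #|J|) delta_mx 0 (enum_val k)) 0 i =
    \sum_k u 0 k * (i == enum_val k)%:R.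
  by rewrite mxE; apply: eq_bigr => k _; rewrite !mxE eqxx.
apply/seteqP; split=> [y ys|_ [u _ <-] i h si].
  exists (\row_k y 0 (enum_val k)) => //; apply/rowP => i.
  rewrite [LHS]mxE mulE mxE; case si : (s i) => [h|].
    rewrite (ys _ _ si) big1 ?addr0// => k _.
    case: eqP => [e|]; last by rewrite mulr0.
    by have := enum_valP k; rewrite inE -e si.
  have Ji : i \in J by rewrite inE si.
  rewrite add0r (bigD1 (enum_rank_in Ji i))//= mxE enum_rankK_in// eqxx mulr1.
  rewrite big1 ?addr0// => k ki; case: eqP => [e|]; last by rewrite mulr0.
  by case/eqP: ki; apply: enum_val_inj; rewrite enum_rankK_in.
rewrite mxE mulE mxE si big1 ?addr0// => k _.
case: eqP => [e|]; last by rewrite mulr0.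
by have := enum_valP k; rewrite inE -e si.
Qed.

End Flats.

Lemma coordB (x y : 'rV[R]_N) i : (x - y) 0 i = x 0 i - y 0 i.
Proof. by rewrite !mxE. Qed.

Lemma rigid_cube_bounded Q b (r : R) (V : set 'rV[R]_N) : 0 <= r ->
  Q *m Q^T = 1%:M -> V `<=` rigid Q b @` cube r ->
  forall x, V x -> enorm x <= Num.sqrt N%:R * r + enorm b.
Proof.
move=> r0 QQ VQ x /VQ [z zr <-]; rewrite /rigid.
by rewrite (le_trans (enormD _ _))// lerD2r enorm_orthogonal// enorm_le_coord.
Qed.

Lemma near_identity_move (Q : 'M[R]_N) b x (eta M : R) : 0 < eta -> 0 <= M ->
  (forall i j, `|Q i j - (i == j)%:R| < eta) -> enorm b < eta -> enorm x <= M ->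
  enorm (rigid Q b x - x) <= (Num.sqrt N%:R * (N%:R * M) + 1) * eta.
Proof.
move=> eta0 M0 Q1 be xM.
have -> : rigid Q b x - x = x *m (Q - 1%:M) + b.
  by rewrite /rigid mulmxBr mulmx1 addrAC.
apply: le_trans (enormD _ _) _; rewrite mulrDl mul1r lerD//; last exact: ltW.
rewrite -mulrA; apply: enorm_le_coord; first by rewrite !mulr_ge0// ltW.
move=> i; rewrite mxE -mulrA mulr_natl -[N in _ *+ N]card_ord -sumr_const.
apply: le_trans (ler_norm_sum _ _ _) _; apply: ler_sum => j _.
rewrite normrM ler_pM//; first by rewrite (le_trans (coord_le_enorm _ _)).
by rewrite !mxE; exact/ltW.
Qed.

Lemma continuous_rigid (Q : 'M[R]_N) b i : continuous (fun x => rigid Q b x 0 i).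
Proof.
have -> : (fun x => rigid Q b x 0 i) = (fun x => \sum_j x 0 j * Q j i + b 0 i).
  by apply/funext => x; rewrite /rigid !mxE.
have cs : continuous (fun x : 'rV[R]_N => \sum_j x 0 j * Q j i).
  apply: continuous_big => [|j _ v]; first exact: add_continuous.
  apply: (@continuousM R); last exact: cst_continuous.
  exact: coord_continuous.
by move=> u; apply: (@continuousD R R^o); [exact: cs|exact: cst_continuous].
Qed.

(** Enlarging t by any amount avoids showing that the size is attained. *)
Lemma set_size_cube (V : set 'rV[R]_N) (t r : R) : (set_size V <= t%:E)%E -> t < r ->
  exists r0 Q b, [/\ 0 <= r0, r0 < r, Q *m Q^T = 1%:M & V `<=` rigid Q b @` cube r0].
Proof.
move=> Vt tr; have : (set_size V < r%:E)%E by apply: le_lt_trans Vt _; rewrite lte_fin.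
move=> /ereal_inf_lt [_ [r0 [r00 [g /rigidE [Q [b [QQ ->]]] Vg]] <-]].
by rewrite lte_fin => r0r; exists r0, Q, b.
Qed.

(** The half-side r of the cube is chosen so that m + 1 cells fill it exactly and
    have diameter eps. The hypothesis on m says t < r, which leaves room to move
    the grid slightly, into general position. *)
Lemma regular_net (mu : forall k : 'I_N.+1, {measure set (G k) -> \bar R})
    (K n m : nat) (V : set 'rV[R]_N) (t eps : R) :
  (forall k, uniform_measure (mu k)) -> regular_set mu K n V ->
  (set_size V <= t%:E)%E -> 0 < eps -> (0 < N)%N ->
  2 * t * Num.sqrt N%:R < m.+1%:R * eps ->
  exists S, eps_net V eps S /\
    exists k, (k <= K * (1 + N * m) ^ n)%N /\ (S #= `I_k)%card.
Proof.
move=> umu [regK reg0] Vt eps0 N0 mt.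
have sN : 0 < Num.sqrt N%:R :> R by rewrite sqrtr_gt0 ltr0n.
pose w := eps / Num.sqrt N%:R.
pose r := m.+1%:R * w / 2.
have tr : t < r.
  by rewrite /r /w mulrA ltr_pdivlMr// ltr_pdivlMr// (mulrC t).
have [r0 [Q0 [b0 [r00 r0r QQ0 V0]]]] := set_size_cube Vt tr.
pose M := Num.sqrt N%:R * r0 + enorm b0.
have M0 : 0 <= M by rewrite addr_ge0 ?enorm_ge0// mulr_ge0// ltW.
(* An eta-small motion displaces the points of norm at most M by D * eta. *)
pose D := Num.sqrt N%:R * (N%:R * M) + 1.
have D0 : 0 < D by rewrite ltr_wpDl// !mulr_ge0// ltW.
pose eta := (r - r0) / D.
have eta0 : 0 < eta by rewrite divr_gt0// subr_gt0.
pose a (h : 'I_m) := - r + h.+1%:R * w.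
pose S := {ffun 'I_N -> option 'I_m}.
pose kk (s : S) : 'I_N.+1 := inord (N - codim s).
have kkE s : kk s = (N - codim s)%N :> nat.
  by rewrite inordK// ltnS leq_subr.
have plane_flat s : is_plane (kk s) (rigid Q0 b0 @` [set y | on_flat a s y]).
  by apply: is_plane_rigid; [exact: rigidP|rewrite kkE; exact: is_plane_flat].
pose L s : G (kk s) := Plane (plane_flat s).
pose B s : set (G (kk s)) := [set L' | if (codim s <= n)%N
  then ~ (path_components (R := R) (V `&` plane_set L') #<= `I_K)%card
  else V `&` plane_set L' <> set0].
have cE s : (N - kk s)%N = codim s by rewrite kkE subKn// codim_le.
have nB s : (mu (kk s)).-negligible (B s).
  rewrite /B; case: leqP => sn; first by apply: regK; rewrite cE.
  by apply: reg0; rewrite cE addn1.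
have [Q [b [QQ Q1 b1 hB]]] := generic_rigid L umu nB eta0.
pose F x := rigid_inv Q0 b0 (rigid Q b x).
have cF i : continuous (fun x => F x 0 i).
  rewrite /F rigid_invE; under eq_fun do rewrite rigid_comp.
  exact: continuous_rigid.
have sliceE s : exists L' : G (kk s), slice V F a s = V `&` plane_set L' /\ ~ B s L'.
  exists (plane_map (rigid_inv_rigid b QQ) (L s)).
  split; last first.
    by apply: hB; rewrite /= (image_cancel _ (rigid_invK b QQ)).
  congr (V `&` _); apply/seteqP; split=> x /=.
    move=> Fx; exists (rigid Q b x); last exact: rigidK.
    by exists (F x) => //; rewrite /F rigid_invK.
  by move=> [_ [y ys <-] <-]; rewrite /F rigid_invK// rigidK.
have [T [TV Tk Tnet]] : exists S0 : set 'rV[R]_N, [/\ S0 `<=` V,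
    exists k, (k <= K * (1 + N * m) ^ n)%N /\ (S0 #= `I_k)%card &
    forall x, V x -> exists2 p, S0 p & cell V F a x p].
  apply: grid_net => // s sn.
    have [L' [-> ]] := sliceE s; rewrite /B /= sn => h; exact: contrapT.
  have [L' [-> ]] := sliceE s; rewrite /B /= leqNgt sn => h; exact: contrapT.
have w0 : 0 < w by rewrite divr_gt0.
have Fr x i : V x -> - r <= F x 0 i <= r.
  move=> Vx; rewrite -ler_norml.
  have [z zr xE] := V0 _ Vx.
  have xM := rigid_cube_bounded r00 QQ0 V0 Vx.
  have e1 : enorm (F x - z) <= r - r0.
    rewrite -[z](rigidK b0 QQ0) xE enorm_rigid_inv//.
    apply: le_trans (near_identity_move eta0 M0 Q1 b1 xM) _.
    by rewrite /eta mulrC divfK ?gt_eqF.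
  have := coord_le_enorm (F x - z) i; rewrite coordB => e2.
  have := zr i => e3; have := ler_normD (F x 0 i - z 0 i) (z 0 i); rewrite subrK.
  lra.
exists T; split=> //; split=> // x Vx; have [p Tp [Vp xp]] := Tnet x Vx.
exists p => //.
have -> : enorm (x - p) = enorm (F x - F p).
  by rewrite enorm_rigid_inv// enorm_rigid.
rewrite -[leRHS](_ : Num.sqrt N%:R * w = eps); last first.
  by rewrite /w mulrC divfK ?gt_eqF.
apply: enorm_le_coord => [|i]; first exact: ltW.
rewrite coordB.
apply: (@grid_width _ m r) => //; [|exact: Fr|exact: Fr|exact: xp].
by rewrite /r; field.
Qed.

End Covering.

(** * The covering bound *)

Section Diameter.
Context {R : realType} {N : nat}.
Implicit Types (V S : set 'rV[R]_N).

Lemma diam_pair V (eps r : R) : (eps%:E <= ediam V)%E -> r < eps ->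
  exists x y, [/\ V x, V y & r < enorm (x - y)].
Proof.
move=> Ve re; have : (r%:E < ediam V)%E by apply: lt_le_trans Ve; rewrite lte_fin.
by move=> /ereal_sup_gt [_ [x Vx [y Vy <-]]]; rewrite lte_fin; exists x, y.
Qed.

(** A cube of half-side t has diameter 2 t sqrt N. *)
Lemma diam_le_size V (eps t : R) : 0 < eps -> (eps%:E <= ediam V)%E ->
  (set_size V <= t%:E)%E -> (0 < N)%N /\ eps <= 2 * t * Num.sqrt N%:R.
Proof.
move=> eps0 Ve Vt.
have N0 : (0 < N)%N.
  have [x [y [_ _]]] := diam_pair Ve eps0.
  case: N x y => // x y; rewrite (thinmx0 (x - y)) enorm0 ltxx//.
split=> //; rewrite leNgt; apply/negP => lt.
have sN : 0 < Num.sqrt N%:R :> R by rewrite sqrtr_gt0 ltr0n.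
have [x [y [Vx Vy xy]]] := diam_pair Ve lt.
have [|r0 [Q [b [r00 r0r QQ VQ]]]] :=
  @set_size_cube R N V t (enorm (x - y) / (2 * Num.sqrt N%:R)) Vt.
  by rewrite ltr_pdivlMr ?mulr_gt0// mulrA (mulrC t).
have [z zr xE] := VQ _ Vx; have [z' zr' yE] := VQ _ Vy.
have : enorm (x - y) <= Num.sqrt N%:R * (2 * r0).
  rewrite -xE -yE enorm_rigid//; apply: enorm_le_coord => [|i]; first by rewrite mulr_ge0.
  have := zr i; have := zr' i; have := ler_normB (z 0 i) (z' 0 i); rewrite coordB; lra.
move: r0r; rewrite ltr_pdivlMr ?mulr_gt0//; lra.
Qed.

Lemma covering_number_le V (eps : R) S k :
  eps_net V eps S -> (S #= `I_k)%card -> (covering_number V eps <= k%:R%:E)%E.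
Proof. by move=> VS Sk; apply: ereal_inf_lbound; exists k => //; exists S. Qed.

Lemma covering_number_ge0 V (eps : R) : (0 <= covering_number V eps)%E.
Proof. by apply: le_ereal_inf_tmp => _ [k _ <-]; rewrite lee_fin. Qed.

End Diameter.

(** Since 1 <= N m0, the left side is at most (2 N m0) ^ n; and 2 ^ n <= 2 n ^ n. *)
Lemma card_slices_le (R : realType) (N m n : nat) (m0 : R) : (0 < N)%N ->
  1 <= m0 -> m%:R <= m0 ->
  ((1 + N * m) ^ n)%:R <= 2 * (n%:R * (N%:R * m0)) ^+ n.
Proof.
move=> N0 m01 mm0; rewrite natrX natrD natrM.
have N1 : 1 <= N%:R :> R by rewrite ler1n.
set y := N%:R * m0.
have y1 : 1 <= y by rewrite -[1]mulr1 ler_pM.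
have le2y : 1%:R + N%:R * m%:R <= 2 * y.
  have : N%:R * m%:R <= y by rewrite ler_wpM2l// (le_trans _ N1).
  lra.
have {le2y}h : (1%:R + N%:R * m%:R) ^+ n <= (2 * y) ^+ n.
  by rewrite lerXn2r// nnegrE ?addr_ge0 ?mulr_ge0//; lra.
apply: le_trans h _; case: n => [|[|n]]; first by rewrite !expr0; lra.
  by rewrite !expr1; lra.
apply: (@le_trans _ _ ((n.+2%:R * y) ^+ n.+2)).
  rewrite lerXn2r// ?nnegrE; [lra|by rewrite mulr_ge0//; lra|].
  by rewrite ler_wpM2r ?ler_nat//; lra.
rewrite -[leLHS]mul1r ler_wpM2r ?exprn_ge0 ?mulr_ge0//; lra.
Qed.

Section Bounds.
Context (R : realType) (N : nat).
Variable mu : forall k : 'I_N.+1, {measure set (affine_grassmannian R k) -> \bar R}.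
Variables (K n : nat) (V : set 'rV[R]_N) (t eps : R).
Hypothesis umu : forall k, uniform_measure (mu k).
Hypothesis regV : regular_set mu K n V.
Hypothesis Vt : (set_size V <= t%:E)%E.
Hypothesis eps0 : 0 < eps.
Hypothesis epsV : (eps%:E <= ediam V)%E.

(** V is nonempty, so its net is not empty either. *)
Lemma regular_K_gt0 : (0 < K)%N.
Proof.
have [N0 _] := diam_le_size eps0 epsV Vt.
pose y := 2 * t * Num.sqrt N%:R / eps.
have [S [[SV net] [k [kK Sk]]]] := regular_net (m := Num.truncn y) umu regV Vt eps0 N0
  ltac:(by rewrite -ltr_pdivrMr// truncnS_gt).
rewrite lt0n; apply/eqP => K0; move: kK Sk; rewrite K0 mul0n leqn0 => /eqP ->.
rewrite II0 card_eq0 => /eqP S0.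
have [x [_ [Vx _ _]]] := diam_pair epsV eps0.
by have [p] := net _ Vx; rewrite S0.
Qed.

(** With n = 0 the net for radius eps / 3 has at most K points, and one ball of
    that radius has diameter less than eps. *)
Lemma regular_K_gt1 : n = 0%N -> (1 < K)%N.
Proof.
move=> n0; have [N0 _] := diam_le_size eps0 epsV Vt.
have eps3 : 0 < eps / 3 by rewrite divr_gt0.
pose y := 2 * t * Num.sqrt N%:R / (eps / 3).
have [S [[SV net] [k [kK Sk]]]] := regular_net (m := Num.truncn y) umu regV Vt eps3 N0
  ltac:(by rewrite -ltr_pdivrMr// truncnS_gt).
rewrite ltnNge; apply/negP => K1; move: kK; rewrite n0 expn0 muln1 => kK.
have S1 p q : S p -> S q -> p = q.
  have /pcard_leP [f] : (S #<= `I_1)%card.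
    by rewrite (card_le_eql Sk) card_le_II (leq_trans kK).
  have f0 z : S z -> f z = 0%N.
    move=> Sz; have : `I_1 (f z) by exact: funS.
    by rewrite /= ltnS leqn0 => /eqP.
  move=> Sp Sq; have e : f p = f q by rewrite !f0.
  exact: (inj (mem_set Sp) (mem_set Sq) e).
have lt23 : 2 * (eps / 3) < eps by move: eps0 => e0; lra.
have [x [y' [Vx Vy]]] := diam_pair epsV lt23.
have [p Sp xp] := net _ Vx; have [q Sq yq] := net _ Vy.
rewrite (S1 _ _ Sq Sp) in yq.
have := enormB x p y'; rewrite (enorm_distC p); lra.
Qed.

Lemma covering_number_bound : (lne (covering_number V eps) <= (covering_bound N K n t eps)%:E)%E.
Proof.
have [N0 epst] := diam_le_size eps0 epsV Vt.
have K0 := regular_K_gt0.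
have N1 : 1 <= N%:R :> R by rewrite ler1n.
pose m0 := 2 * t * Num.sqrt N%:R / eps.
have m01 : 1 <= m0 by rewrite ler_pdivlMr// mul1r.
have m00 : 0 < m0 by exact: lt_le_trans m01.
pose m := Num.truncn m0.
have mm0 : m%:R <= m0 by rewrite truncn_le// ltW.
have [|S [net [k [kK Sk]]]] := regular_net (m := m) umu regV Vt eps0 N0.
  by rewrite -ltr_pdivrMr// truncnS_gt.
pose y := n%:R * (N%:R * m0).
have cov : (covering_number V eps <= (2 * K%:R * y ^+ n)%:E)%E.
  apply: le_trans (covering_number_le net Sk) _; rewrite lee_fin.
  apply: (@le_trans _ _ (K%:R * ((1 + N * m) ^ n)%:R)); first by rewrite -natrM ler_nat.
  by rewrite (mulrC 2) -mulrA ler_pM2l ?ltr0n//; exact: card_slices_le.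
have y0 : (0 < n)%N -> 0 < y.
  by move=> n0; do 2?apply: mulr_gt0; rewrite ?ltr0n.
have yn0 : 0 < y ^+ n.
  by have [->|/y0 n0] := posnP n; rewrite ?expr0// exprn_gt0.
have K2 : 0 < 2 * K%:R :> R by rewrite mulr_gt0// ltr0n.
apply: (@le_trans _ _ (lne (2 * K%:R * y ^+ n)%:E)).
  rewrite lee_lne// in_itv /= leey andbT; first exact: covering_number_ge0.
  by rewrite lee_fin mulr_ge0// ltW.
have p0 : 0 < 2 * K%:R * y ^+ n by exact: mulr_gt0.
rewrite lne_EFin// lee_fin /covering_bound lnM ?posrE// addrC lerD2r.
have [n0|n0] := posnP n; first by rewrite n0 expr0 ln1 mul0r.
have {}y0 := y0 n0.
have yE : y = 2 * t * n%:R * N%:R `^ (3 / 2) / eps.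
  rewrite (_ : 3 / 2 = 1 + 2^-1); last by field.
  rewrite powRD ?powRr1// ?powR12_sqrt//; last first.
    by apply/implyP => _; rewrite pnatr_eq0 -lt0n.
  by rewrite /y /m0; field; rewrite gt_eqF.
by rewrite lnXn// -yE -[leLHS]mulr_natl.
Qed.

Lemma covering_bound_asymp : (2 <= N)%N -> (n <= N)%N ->
  `|covering_bound N K n t eps - n%:R * ln (t / eps)|
        <= 5 * (n%:R * ln N%:R + ln K%:R).
Proof.
move=> N2 nN; have [N0 epst] := diam_le_size eps0 epsV Vt.
have K0 := regular_K_gt0.
have lnK : 0 <= ln K%:R :> R by rewrite ln_ge0// ler1n.
have l2 : 0 <= ln 2 :> R by rewrite ln_ge0// ler1n.
have l2N : ln 2 <= ln N%:R :> R.
  by rewrite ler_ln ?posrE ?ltr0n// ler_nat.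
have lN : 0 <= ln N%:R :> R by exact: le_trans l2N.
have ln2K : ln (2 * K%:R) = ln 2 + ln K%:R :> R by rewrite lnM ?posrE ?ltr0n.
rewrite /covering_bound ln2K.
have [n0|n0] := posnP n.
  have K1 := regular_K_gt1 n0.
  have l2K : ln 2 <= ln K%:R :> R by rewrite ler_ln ?posrE ?ltr0n// ler_nat.
  rewrite n0 !mul0r !add0r subr0 ger0_norm ?addr_ge0//; lra.
have t0 : 0 < t.
  have : 0 < 2 * t * Num.sqrt N%:R by apply: lt_le_trans epst.
  by rewrite pmulr_lgt0 ?sqrtr_gt0 ?ltr0n// pmulr_rgt0.
have te : 0 < t / eps by rewrite divr_gt0.
have P0 : 0 < N%:R `^ (3 / 2) :> R by rewrite powR_gt0// ltr0n.
have nR : 0 < n%:R :> R by rewrite ltr0n.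
rewrite (_ : 2 * t * n%:R * N%:R `^ (3 / 2) / eps =
  2 * n%:R * N%:R `^ (3 / 2) * (t / eps)); last first.
  by field; rewrite gt_eqF.
move: (t / eps) te => q q0.
rewrite lnM ?posrE ?mulr_gt0// lnM ?posrE ?mulr_gt0// lnM ?posrE// ln_powR.
have n1 : 1 <= n%:R :> R by rewrite ler1n.
have ln0 : 0 <= ln n%:R :> R by exact: ln_ge0.
have lnN : ln n%:R <= ln N%:R :> R by rewrite ler_ln ?posrE ?ltr0n// ler_nat.
set A := ln 2 in l2 l2N *; set B := ln n%:R in ln0 lnN *.
set C := ln N%:R in l2N lN lnN *; set D := ln K%:R in lnK *.
set E := ln q.
rewrite (_ : _ - _ = n%:R * (A + B + 3 / 2 * C) + A + D); last by field.
rewrite ger0_norm; last by rewrite !addr_ge0// mulr_ge0//; lra.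
have h1 : n%:R * (A + B + 3 / 2 * C) <= n%:R * (7 / 2 * C).
  by rewrite ler_wpM2l//; lra.
have h2 : C <= n%:R * C by rewrite ler_peMl.
lra.
Qed.

End Bounds.

Theorem theorem2p6 (R : realType) :
  exists C : R,
    forall (N : nat)
      (mu : forall k : 'I_N.+1,
        {measure set (affine_grassmannian R k) -> \bar R})
      (K n : nat) (V : set 'rV[R]_N) (t eps : R),
    (forall k, uniform_measure (mu k)) ->
    regular_set mu K n V ->
    (set_size V <= t%:E)%E ->
    0 < eps -> (eps%:E <= ediam V)%E ->
    (lne (covering_number V eps) <= (covering_bound N K n t eps)%:E)%E /\
    ((2 <= N)%N -> (n <= N)%N ->
      `|covering_bound N K n t eps - n%:R * ln (t / eps)|
        <= C * (n%:R * ln N%:R + ln K%:R)).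
Proof.
exists 5 => N mu K n V t eps umu regV Vt eps0 epsV; split.
  exact: covering_number_bound umu regV Vt eps0 epsV.
exact: covering_bound_asymp umu regV Vt eps0 epsV.
Qed.
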